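(* Let $L$ be the Lagrangian, $L^{*,\rho}=\rho\,\partial L/\partial\rho-L$, $K=\partial L/\partial\mathbf u$, $M=\partial L/\partial(\mathrm D_t\alpha)$, $P=\partial L/\partial(\mathrm D_ta_{\mathrm i})$, all as defined in the context, and let $$\mathcal E(\rho,K,M,P,\alpha,a_{\mathrm i},s,s_1,s_2,y)=\mathbf u\cdot K+M\,\mathrm D_t\alpha+P\,\mathrm D_ta_{\mathrm i}-L$$ be the partial Legendre transform of $L$ with respect to $(\mathbf u,\mathrm D_t\alpha,\mathrm D_ta_{\mathrm i})$. Consider the system $$\begin{cases} \partial_t\rho+\operatorname{div}(\rho\mathbf u)=0,\qquad \mathrm D_ty=0,\\ \mathrm D_ts=0,\qquad \mathrm D_ts_1=0,\qquad \mathrm D_ts_2=0,\\ \partial_tM+\operatorname{div}(M\mathbf u)-\dfrac{\partial L}{\partial\alpha}=0,\\ \partial_tP+\operatorname{div}(P\mathbf u)-\dfrac{\partial L}{\partial a_{\mathrm i}}=0,\\ \partial_tK+\operatorname{div}(K\mathbf u)-\nabla L^{*,\rho}=0. \end{cases}$$ Then (for smooth solutions) $\mathcal E$ satisfies the additional scalar conservation equation $$\partial_t\mathcal E+\operatorname{div}\big((\mathcal E-L^{*,\rho})\mathbf u\big)=0.$$ Moreover, if $\mathcal E(\rho,K,M,P,\alpha,a_{\mathrm i},s,s_1,s_2,y)$ is convex, then the system is hyperbolic and it is symmetrizable.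
   Context: Unknowns are functions of $(t,\mathbf x)\in\mathbb R\times\mathbb R^3$: mixture density $\rho>0$, velocity $\mathbf u\in\mathbb R^3$, mass fraction $y\in(0,1)$ and volume fraction $\alpha\in(0,1)$ of phase 1, interfacial area density $a_{\mathrm i}>0$, specific mixture entropy $s$ and specific phasic entropies $s_1,s_2$. The material derivative is $\mathrm D_t=\partial_t+\mathbf u\cdot\nabla_{\mathbf x}$, and $\operatorname{div},\nabla$ are in $\mathbf x$; $\operatorname{div}(K\mathbf u)$ is the vector with components $\sum_j\partial_j(K_iu_j)$. Each phase $k=1,2$ has a $\mathcal C^2$ specific internal energy $e_k(\tau_k,s_k)$, with $\tau_k$ the specific volume, and $p_k=-\partial e_k/\partial\tau_k$, $T_k=\partial e_k/\partial s_k>0$. The interface has an energy per unit area $e_{\mathrm i}(s_{\mathrm i})$, smooth, with $T_{\mathrm i}=e_{\mathrm i}'(s_{\mathrm i})$ and $\gamma_{\mathrm i}=e_{\mathrm i}-T_{\mathrm i}s_{\mathrm i}$. The mixture specific energy is $$e(\rho,s,s_1,s_2,a_{\mathrm i},y,\alpha)=y\,e_1\Big(\frac{\alpha}{y\rho},s_1\Big)+(1-y)\,e_2\Big(\frac{1-\alpha}{(1-y)\rho},s_2\Big)+\frac{a_{\mathrm i}}{\rho}\,e_{\mathrm i}\Big(\frac{\rho\,(s-ys_1-(1-y)s_2)}{a_{\mathrm i}}\Big).$$ The Lagrangian is the function of the independent variables $(\rho,s,s_1,s_2,a_{\mathrm i},y,\alpha,\mathbf u,\mathrm D_t\alpha,\mathrm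 D_ta_{\mathrm i})$ $$L=\tfrac12\rho|\mathbf u|^2+\tfrac m2|\mathrm D_t\alpha|^2+\tfrac\nu2|\mathrm D_ta_{\mathrm i}|^2-\rho\,e(\rho,s,s_1,s_2,a_{\mathrm i},y,\alpha),$$ with constants $m,\nu>0$. Partial derivatives of $L$ are taken with respect to these variables. Thus $K=\rho\mathbf u$, $M=m\,\mathrm D_t\alpha$, $P=\nu\,\mathrm D_ta_{\mathrm i}$; when the system is viewed as a first-order system in $(\rho,K,M,P,\alpha,a_{\mathrm i},s,s_1,s_2,y)$, the relations $\mathrm D_t\alpha=M/m$ and $\mathrm D_ta_{\mathrm i}=P/\nu$ are the evolution equations for $\alpha$ and $a_{\mathrm i}$, and $\mathbf u=K/\rho$. Hyperbolic and symmetrizable have their usual meaning for first-order quasilinear systems (with zeroth-order source terms). *)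

(* Defs.v *)
From HB Require Import structures.
From mathcomp Require Import all_boot all_order all_algebra.
From mathcomp Require Import all_classical all_reals all_analysis.
From mathcomp Require Import ring.

Set Implicit Arguments.
Unset Strict Implicit.
Unset Printing Implicit Defensive.

Import Order.TTheory GRing.Theory Num.Theory.
Import numFieldNormedType.Exports.

Local Open Scope classical_set_scope.
Local Open Scope ring_scope.

(* [f] is of class C^n on the set [U] (meant to be open, in a
   finite-dimensional space): all iterated directional derivatives up to order
   n exist and are continuous at the points of [U]. *)
Fixpoint class_C (R : realType) (V W : normedModType R) (n : nat) (U : set V)
    (f : V -> W) : Prop :=
  match n with
  | 0%N => forall x, U x -> {for x, continuous f}
  | n'.+1 => (forall x, U x -> differentiable f x) /\
             forall v, class_C n' U ('D_v f)
  end.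

Definition spacetime (R : realType) := (R * 'rV[R]_3)%type.

Definition dt (R : realType) (V : normedModType R) (f : spacetime R -> V) :
  spacetime R -> V := 'D_((1, 0) : spacetime R) f.

Definition dx (R : realType) (V : normedModType R) (j : 'I_3)
  (f : spacetime R -> V) : spacetime R -> V :=
  'D_((0, delta_mx 0 j) : spacetime R) f.

Definition divx (R : realType) (F : spacetime R -> 'rV[R]_3)
  (z : spacetime R) : R := \sum_(j < 3) dx j (fun z' => F z' 0 j) z.

Definition dot3 (R : realType) (v w : 'rV[R]_3) : R :=
  \sum_(j < 3) v 0 j * w 0 j.

Definition Dt (R : realType) (u : spacetime R -> 'rV[R]_3)
  (f : spacetime R -> R) (z : spacetime R) : R :=
  dt f z + \sum_(j < 3) u z 0 j * dx j f z.

(* The constitutive data: phasic energies e_k as functions of the pair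
   (tau_k, s_k), the interfacial energy and the two inertia constants. *)
Record two_phase_model (R : realType) := TwoPhaseModel {
  e1 : R * R -> R;
  e2 : R * R -> R;
  ei : R -> R;
  inertia_m : R;
  inertia_nu : R
}.

Definition temperature (R : realType) (e : R * R -> R) (tau s : R) : R :=
  'D_((0, 1) : R * R) e (tau, s).

Definition mixture_energy (R : realType) (X : two_phase_model R)
    (rho s s1 s2 a y al : R) : R :=
  y * e1 X (al / (y * rho), s1)
  + (1 - y) * e2 X ((1 - al) / ((1 - y) * rho), s2)
  + a / rho * ei X (rho * (s - y * s1 - (1 - y) * s2) / a).

(* [dal] and [da] are the slots of D_t alpha and D_t a_i, which are independent
   variables of the Lagrangian. *)
Definition lagrangian (R : realType) (X : two_phase_model R)
    (rho s s1 s2 a y al : R) (u : 'rV[R]_3) (dal da : R) : R :=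
  2^-1 * rho * dot3 u u + inertia_m X / 2 * dal ^+ 2 + inertia_nu X / 2 * da ^+ 2
  - rho * mixture_energy X rho s s1 s2 a y al.

(* States W = (rho, K, M, P, alpha, a_i, s, s_1, s_2, y), in this order. *)
Definition state (R : realType) := 'cV[R]_12.

Definition w_rho (R : realType) (w : state R) : R := w (@Ordinal 12 0 isT) 0.
Definition w_K (R : realType) (w : state R) : 'rV[R]_3 :=
  \row_(j < 3) w (rshift 1 (lshift 8 j)) 0.
Definition w_M (R : realType) (w : state R) : R := w (@Ordinal 12 4 isT) 0.
Definition w_P (R : realType) (w : state R) : R := w (@Ordinal 12 5 isT) 0.
Definition w_al (R : realType) (w : state R) : R := w (@Ordinal 12 6 isT) 0.
Definition w_a (R : realType) (w : state R) : R := w (@Ordinal 12 7 isT) 0.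
Definition w_s (R : realType) (w : state R) : R := w (@Ordinal 12 8 isT) 0.
Definition w_s1 (R : realType) (w : state R) : R := w (@Ordinal 12 9 isT) 0.
Definition w_s2 (R : realType) (w : state R) : R := w (@Ordinal 12 10 isT) 0.
Definition w_y (R : realType) (w : state R) : R := w (@Ordinal 12 11 isT) 0.

Definition admissible (R : realType) : set (state R) :=
  [set w | [/\ 0 < w_rho w, 0 < w_y w < 1, 0 < w_al w < 1 & 0 < w_a w]].

(* The velocities (u, D_t alpha, D_t a_i) conjugate to (K, M, P); see
   [conjugate_momenta] below. *)
Definition w_u (R : realType) (w : state R) : 'rV[R]_3 :=
  (w_rho w)^-1 *: w_K w.
Definition w_dal (R : realType) (X : two_phase_model R) (w : state R) : R :=
  w_M w / inertia_m X.
Definition w_da (R : realType) (X : two_phase_model R) (w : state R) : R :=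
  w_P w / inertia_nu X.

Definition L_at (R : realType) (X : two_phase_model R) (w : state R) : R :=
  lagrangian X (w_rho w) (w_s w) (w_s1 w) (w_s2 w) (w_a w) (w_y w) (w_al w)
    (w_u w) (w_dal X w) (w_da X w).

Definition dL_drho (R : realType) (X : two_phase_model R) (w : state R) : R :=
  derive1 (fun r : R => lagrangian X r (w_s w) (w_s1 w) (w_s2 w) (w_a w) (w_y w)
     (w_al w) (w_u w) (w_dal X w) (w_da X w)) (w_rho w).

Definition dL_dal (R : realType) (X : two_phase_model R) (w : state R) : R :=
  derive1 (fun al : R => lagrangian X (w_rho w) (w_s w) (w_s1 w) (w_s2 w) (w_a w)
     (w_y w) al (w_u w) (w_dal X w) (w_da X w)) (w_al w).

Definition dL_da (R : realType) (X : two_phase_model R) (w : state R) : R :=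
  derive1 (fun a : R => lagrangian X (w_rho w) (w_s w) (w_s1 w) (w_s2 w) a
     (w_y w) (w_al w) (w_u w) (w_dal X w) (w_da X w)) (w_a w).

Definition dL_du (R : realType) (X : two_phase_model R) (w : state R) :
    'rV[R]_3 :=
  \row_(j < 3) 'D_(delta_mx 0 j) (fun u : 'rV[R]_3 =>
     lagrangian X (w_rho w) (w_s w) (w_s1 w) (w_s2 w) (w_a w) (w_y w) (w_al w)
       u (w_dal X w) (w_da X w)) (w_u w).

Definition dL_ddal (R : realType) (X : two_phase_model R) (w : state R) : R :=
  derive1 (fun dal : R => lagrangian X (w_rho w) (w_s w) (w_s1 w) (w_s2 w) (w_a w)
     (w_y w) (w_al w) (w_u w) dal (w_da X w)) (w_dal X w).

Definition dL_dda (R : realType) (X : two_phase_model R) (w : state R) : R :=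
  derive1 (fun da : R => lagrangian X (w_rho w) (w_s w) (w_s1 w) (w_s2 w) (w_a w)
     (w_y w) (w_al w) (w_u w) (w_dal X w) da) (w_da X w).

Lemma conjugate_momenta (R : realType) (X : two_phase_model R) (w : state R) :
  0 < inertia_m X -> 0 < inertia_nu X -> 0 < w_rho w ->
  [/\ w_K w = dL_du X w, w_M w = dL_ddal X w & w_P w = dL_dda X w].
Proof.
move=> m0 nu0 r0.
have quad (c k x : R) :
    derive1 (fun h : R => c / 2 * h ^+ 2 + k) x = c * x.
  rewrite derive1E.
  have -> : (fun h : R => c / 2 * h ^+ 2 + k) = (c / 2) \*: (@id R ^+ 2) + cst k.
    by apply/funext => h.
  rewrite derive_val /= expr1 /GRing.scale/= addr0 mulr1; by field.
split.
- apply/rowP => j; rewrite [RHS]mxE.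
  set k := inertia_m X / 2 * w_dal X w ^+ 2 + inertia_nu X / 2 * w_da X w ^+ 2
    - w_rho w * mixture_energy X (w_rho w) (w_s w) (w_s1 w) (w_s2 w) (w_a w)
        (w_y w) (w_al w).
  rewrite (_ : (fun u => _) = (fun u : 'rV[R]_3 => 2^-1 * w_rho w * dot3 u u + k));
    last by apply/funext => u; rewrite /lagrangian /k !addrA.
  pose g := fun h : R => w_rho w / 2 * h ^+ 2 + k.
  have -> : 'D_(delta_mx 0 j) (fun u : 'rV[R]_3 => 2^-1 * w_rho w * dot3 u u + k)
      (w_u w) = derive1 g (w_u w 0 j).
    rewrite /derive /derive1; set F := (fun h : R => h^-1 *: _).
    set G := (fun h : R => h^-1 *: _); suff -> : F = G by [].
    apply/funext => h; rewrite /F /G /g /=; congr (_ *: _).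
    have cancel_k (p q : R) : p + k - (q + k) = p - q by ring.
    rewrite !cancel_k -!mulrBr.
    rewrite /dot3 -sumrB (bigD1 j)//= big1; last first.
      by move=> i ij; rewrite !mxE eqxx (negbTE ij) mulr0 add0r subrr.
    rewrite addr0 !mxE !eqxx /= mulr1; by ring.
  by rewrite quad /w_u !mxE mulrA divff ?mul1r// gt_eqF.
- rewrite /dL_ddal; set k := lagrangian X (w_rho w) (w_s w) (w_s1 w) (w_s2 w)
    (w_a w) (w_y w) (w_al w) (w_u w) 0 (w_da X w).
  rewrite (_ : (fun dal => _) = (fun h : R => inertia_m X / 2 * h ^+ 2 + k)).
    by rewrite quad /w_dal mulrC divfK// gt_eqF.
  by apply/funext => h; rewrite /k /lagrangian; ring.
- rewrite /dL_dda; set k := lagrangian X (w_rho w) (w_s w) (w_s1 w) (w_s2 w)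
    (w_a w) (w_y w) (w_al w) (w_u w) (w_dal X w) 0.
  rewrite (_ : (fun da => _) = (fun h : R => inertia_nu X / 2 * h ^+ 2 + k)).
    by rewrite quad /w_da mulrC divfK// gt_eqF.
  by apply/funext => h; rewrite /k /lagrangian; ring.
Qed.

Definition Lstar (R : realType) (X : two_phase_model R) (w : state R) : R :=
  w_rho w * dL_drho X w - L_at X w.

Definition total_energy (R : realType) (X : two_phase_model R) (w : state R) :
    R :=
  dot3 (w_u w) (w_K w) + w_M w * w_dal X w + w_P w * w_da X w - L_at X w.

Definition euler_lagrange_system (R : realType) (X : two_phase_model R)
    (W : spacetime R -> state R) (z : spacetime R) : Prop :=
  let u := fun z' => w_u (W z') in
  [/\ dt (fun z' => w_rho (W z')) z
        + divx (fun z' => w_rho (W z') *: u z') z = 0,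
      [/\ Dt u (fun z' => w_y (W z')) z = 0,
          Dt u (fun z' => w_s (W z')) z = 0,
          Dt u (fun z' => w_s1 (W z')) z = 0 &
          Dt u (fun z' => w_s2 (W z')) z = 0],
      Dt u (fun z' => w_al (W z')) z = w_dal X (W z) /\
      Dt u (fun z' => w_a (W z')) z = w_da X (W z),
      dt (fun z' => w_M (W z')) z + divx (fun z' => w_M (W z') *: u z') z
        - dL_dal X (W z) = 0 /\
      dt (fun z' => w_P (W z')) z + divx (fun z' => w_P (W z') *: u z') z
        - dL_da X (W z) = 0 &
      forall i : 'I_3,
        dt (fun z' => w_K (W z') 0 i) z
          + divx (fun z' => w_K (W z') 0 i *: u z') z
          - dx i (fun z' => Lstar X (W z')) z = 0].

(* The first-order system [sys] is, for states in [Om], the quasilinear system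
   dt W + \sum_j A j (W) dx_j W = S (W).  As the values of W and of its first
   derivatives at a point are arbitrary, this determines A and S on an open
   set [Om]. *)
Definition quasilinear_form (R : realType) (n : nat)
    (sys : (spacetime R -> 'cV[R]_n.+1) -> spacetime R -> Prop)
    (Om : set 'cV[R]_n.+1) (A : 'I_3 -> 'cV[R]_n.+1 -> 'M[R]_n.+1)
    (S : 'cV[R]_n.+1 -> 'cV[R]_n.+1) : Prop :=
  forall (W : spacetime R -> 'cV[R]_n.+1) (z : spacetime R),
    differentiable W z -> Om (W z) ->
    (sys W z <->
     dt W z + \sum_(j < 3) A j (W z) *m dx j W z = S (W z)).

(* [diagonalizable] is over the real field R, hence entails that all the
   eigenvalues are real. *)
Definition hyperbolic (R : realType) (n : nat) (Om : set 'cV[R]_n.+1)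
    (A : 'I_3 -> 'cV[R]_n.+1 -> 'M[R]_n.+1) : Prop :=
  forall w, Om w -> forall xi : 'rV[R]_3, xi != 0 ->
    diagonalizable (\sum_(j < 3) xi 0 j *: A j w).

Definition posdef (R : realType) (n : nat) (H : 'M[R]_n) : Prop :=
  H \is symmetricmx /\
  forall v : 'cV[R]_n, v != 0 -> 0 < (v^T *m H *m v) 0 0.

(* Symmetrizability in the sense of Friedrichs, with a continuous
   symmetrizer. *)
Definition symmetrizable (R : realType) (n : nat) (Om : set 'cV[R]_n.+1)
    (A : 'I_3 -> 'cV[R]_n.+1 -> 'M[R]_n.+1) : Prop :=
  exists H : 'cV[R]_n.+1 -> 'M[R]_n.+1,
    forall w, Om w ->
      [/\ {for w, continuous H}, posdef (H w) &
          forall j : 'I_3, H w *m A j w \is symmetricmx].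

(* Main.v *)
Require Import Defs.
From HB Require Import structures.
From mathcomp Require Import all_boot all_order all_algebra.
From mathcomp Require Import all_classical all_reals all_analysis.
From mathcomp Require Import ring lra.

Set Implicit Arguments.
Unset Strict Implicit.
Unset Printing Implicit Defensive.

Import Order.TTheory GRing.Theory Num.Theory.
Import numFieldNormedType.Exports.

Local Open Scope classical_set_scope.
Local Open Scope ring_scope.

(* With r = (rho, K, M, P, 0, ...), Pi = - L^{*,rho}, g = grad Pi and
   d_j = (e_{K_j} - u_j e_rho) / rho, the gradient of u_j, the system reads
     D_t W + \sum_j (r d_j^T + e_{K_j} g^T) (dW / dx_j) = S.
   The conservation law is the chain rule together with grad E . r = E + Pi,
   grad E . e_{K_j} = u_j and grad E . S = 0.

   The quadratic form g . r = r^T (Hess E) r is nonnegative by convexity.  It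
   is even positive: if it vanished, the positivity of Hess E on the directions
   r, e_alpha, e_{s_1} + y e_s and e_s would force d^2 e_k / d tau_k^2 = 0 for
   both phases, hence d^2 e_1 / d tau_1 d s_1 = 0, and then T_1 = 0.
   Convexity being weak, Hess E itself need not be a symmetrizer.  But since
   g . r > 0, d_j . r = 0 and g . e_{K_j} = 0, the matrix r d^T + e g^T is
   annihilated by X (X^2 - l^2) with l^2 = (d . e) (g . r) > 0, and there is an
   explicit positive definite H with H r = g and H e_{K_j} = d_j. *)

(** * Derivatives and functions of class C^n *)

(** The obstacle is that alpha, a_i, s, s_1, s_2 and y are transported, not conserved. With P the
    projection w -> r, differentiating Pi = r . grad E - E gives g = (Hess E) r - (1 - P) grad E.
    Hence (Hess E) e_{K_j} = d_j, but (Hess E) r differs from g in general, even for a definite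
    Hessian. Only the scalar g . r = r^T (Hess E) r survives, since (1 - P) r = 0; so H is
    prescribed on r and the e_{K_j} and completed by a projection.

    For a covector xi, l^2 = |xi|^2 (g . r) / rho: (g . r) / rho is a squared speed of sound.

    The temperature enters because the mass y rho grows along r while s_1 is an entropy per unit
    mass: the coupling of r with e_{s_1} + y e_s contains 2 y rho T_1. If r^T (Hess E) r vanished,
    the second variation would be affine in the amplitude along r, and its nonnegativity would kill
    every coupling with r. The share y e_s keeps s - y s_1 - (1 - y) s_2 fixed, so that the
    interface does not see a change of s_1.

    Second derivatives are computed on explicit lines, where E becomes a sum of functions of one
    variable. *)

Lemma near_eq_differentiable (R : numFieldType) (V W : normedModType R)
    (f g : V -> W) (x : V) :
  (\near x, f x = g x) -> differentiable f x -> differentiable g x.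
Proof.
move=> fg df.
have fgx : f x = g x := nbhs_singleton fg.
have gE : g \o shift x = cst (g x) + 'd f x +o_ 0 id.
  apply/eqaddoP => e e0.
  have /eqaddoP/(_ e e0) := diff_locally df.
  have : \forall h \near (0 : V), f (h + x) = g (h + x).
    by move/nbhs0P : fg; apply: filterS => h; rewrite addrC.
  by apply: filterS2 => h fgh; rewrite /= -fgx !fctE /= fgh.
have dgE : 'd g x = 'd f x :> (V -> W).
  by apply: diff_unique gE; exact: diff_continuous.
by apply/diff_locallyP; rewrite dgE; split => //; exact: diff_continuous.
Qed.

Lemma derive_comp (R : numFieldType) (U V W : normedModType R) (f : U -> V)
    (g : V -> W) (x v : U) :
  differentiable f x -> differentiable g (f x) ->
  'D_v (g \o f) x = 'D_('D_v f x) g (f x).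
Proof.
move=> df dg.
have -> : 'D_v f x = 'd f x v by rewrite deriveE.
rewrite [RHS]deriveE// deriveE; last exact: differentiable_comp.
by rewrite diff_comp.
Qed.

Lemma deriveDdir (R : numFieldType) (V W : normedModType R) (f : V -> W)
    (x u v : V) :
  differentiable f x -> 'D_(u + v) f x = 'D_u f x + 'D_v f x.
Proof. by move=> df; rewrite !deriveE// linearD. Qed.

Lemma deriveZdir (R : numFieldType) (V W : normedModType R) (f : V -> W)
    (x v : V) (c : R) :
  differentiable f x -> 'D_(c *: v) f x = c *: 'D_v f x.
Proof. by move=> df; rewrite !deriveE// linearZ. Qed.

Lemma derive_sumdir (R : numFieldType) (V W : normedModType R) (f : V -> W)
    (x : V) (n : nat) (v : 'I_n -> V) :
  differentiable f x -> 'D_(\sum_i v i) f x = \sum_i 'D_(v i) f x.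
Proof.
by move=> df; rewrite deriveE// linear_sum; apply: eq_bigr => i _; rewrite deriveE.
Qed.

Lemma differentiable_pair_fun (R : numFieldType) (V : normedModType R)
    (f : R * R -> R) (p q : V -> R) (x : V) :
  differentiable p x -> differentiable q x -> differentiable f (p x, q x) ->
  differentiable (fun y => f (p y, q y)) x.
Proof.
move=> dp dq df.
exact: (@differentiable_comp _ _ _ _ (fun y => (p y, q y)) f x
  (differentiable_pair dp dq) df).
Qed.

Lemma derive_pair_fun (R : numFieldType) (V : normedModType R)
    (f : R * R -> R) (p q : V -> R) (x v : V) :
  differentiable p x -> differentiable q x -> differentiable f (p x, q x) ->
  'D_v (fun y => f (p y, q y)) x =
    'D_v p x * 'D_((1, 0) : R * R) f (p x, q x)
    + 'D_v q x * 'D_((0, 1) : R * R) f (p x, q x).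
Proof.
move=> dp dq df.
rewrite (@derive_comp _ _ _ _ (fun y => (p y, q y)) f x v
  (differentiable_pair dp dq) df).
have -> : 'D_v (fun y => (p y, q y)) x =
    'D_v p x *: ((1, 0) : R * R) + 'D_v q x *: ((0, 1) : R * R).
  rewrite deriveE; last exact: differentiable_pair.
  rewrite diff_pair// /GRing.scale /= /GRing.add /= /add_pair /=.
  by rewrite /GRing.scale /= !mulr1 !mulr0 addr0 add0r !deriveE.
by rewrite deriveDdir// !deriveZdir.
Qed.

Section class_C_theory.
Variables (R : realType) (V : normedModType R) (U : set V) (oU : open U).
Implicit Types f g : V -> R.

Lemma class_C_near_eq f g x :
  {in U, f =1 g} -> U x -> \near x, f x = g x.
Proof.
move=> fg Ux; have := open_nbhs_nbhs (conj oU Ux).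
by apply: filterS => y Uy; apply: fg; rewrite inE.
Qed.

(** Formulas for derivatives hold only at points of [U], whereas [class_C] speaks of the globally
    defined functions ['D_v f]. This lemma lets the closure lemmas below exchange ['D_v f] for its
    formula; openness of [U] turns equality on [U] into equality near each point. *)
Lemma class_C_eq n f g : {in U, f =1 g} -> class_C n U f -> class_C n U g.
Proof.
elim: n f g => [|n ih] f g fg /=.
  move=> cf x Ux; have fgn := class_C_near_eq fg Ux.
  rewrite /prop_for /continuous_at -(nbhs_singleton fgn).
  exact: cvg_trans (near_eq_cvg fgn) (cf x Ux).
move=> [df dvf]; split=> [x Ux|v].
  exact: near_eq_differentiable (class_C_near_eq fg Ux) (df x Ux).
apply: (ih _ _ _ (dvf v)) => x /[!inE] Ux.
exact: near_eq_derive (class_C_near_eq fg Ux).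
Qed.

Lemma class_CS n f : class_C n.+1 U f -> class_C n U f.
Proof.
elim: n f => [|n ih] f.
  by move=> [df _] x Ux; apply: differentiable_continuous; apply: df.
by move=> [df dvf]; split=> // v; apply: ih.
Qed.

Lemma class_C_cst n (c : R) : class_C n U (fun=> c).
Proof.
elim: n c => [|n ih] c /=; first by move=> x _; apply: cvg_cst.
split=> [x _|v]; first exact: differentiable_cst.
by apply: (class_C_eq _ (ih 0)) => x _; rewrite derive_cst.
Qed.

Lemma class_C_linear n (f : {linear V -> R}) : continuous f -> class_C n U f.
Proof.
move=> cf; case: n => [|n] /=; first by move=> x _; apply: cf.
split=> [x _|v]; first exact: linear_differentiable.
apply: (class_C_eq _ (class_C_cst n (f v))) => x _.
by rewrite deriveE ?diff_lin//; exact: linear_differentiable.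
Qed.

Lemma class_CD n f g :
  class_C n U f -> class_C n U g -> class_C n U (fun x => f x + g x).
Proof.
elim: n f g => [|n ih] f g /=.
  by move=> cf cg x Ux; apply: cvgD; [exact: cf|exact: cg].
move=> [df dvf] [dg dvg]; split=> [x Ux|v].
  exact: differentiableD (df _ Ux) (dg _ Ux).
apply: (class_C_eq _ (ih _ _ (dvf v) (dvg v))) => x /[!inE] Ux.
by rewrite deriveD//; apply: diff_derivable; [exact: df|exact: dg].
Qed.

Lemma class_CM n f g :
  class_C n U f -> class_C n U g -> class_C n U (fun x => f x * g x).
Proof.
elim: n f g => [|n ih] f g.
  by move=> cf cg x Ux; apply: cvgM; [exact: cf|exact: cg].
move=> cf cg; have [df dvf] := cf; have [dg dvg] := cg; split=> [x Ux|v].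
  exact: differentiableM (df _ Ux) (dg _ Ux).
have := class_CD (ih _ _ (class_CS cf) (dvg v)) (ih _ _ (class_CS cg) (dvf v)).
apply: class_C_eq => x /[!inE] Ux.
by rewrite deriveM//; apply: diff_derivable; [exact: df|exact: dg].
Qed.

Lemma class_CN n f : class_C n U f -> class_C n U (fun x => - f x).
Proof.
move=> cf; apply: (class_C_eq _ (class_CM (class_C_cst n (-1)) cf)) => x _.
by rewrite mulN1r.
Qed.

Lemma class_C_sum n m (F : 'I_m -> V -> R) :
  (forall i, class_C n U (F i)) -> class_C n U (fun x => \sum_i F i x).
Proof.
elim: m F => [|m ih] F cF.
  by apply: (class_C_eq _ (class_C_cst n 0)) => x _; rewrite big_ord0.
apply: (class_C_eq _ (class_CD (cF ord0) (ih _ (fun i => cF (lift ord0 i))))).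
by move=> x _; rewrite big_ord_recl.
Qed.

Lemma class_CV n f :
  {in U, forall x, f x != 0} -> class_C n U f -> class_C n U (fun x => (f x)^-1).
Proof.
move=> f0; elim: n f f0 => [|n ih] f f0 cf.
  by move=> x Ux; apply: cvgV; [apply: f0; rewrite inE|exact: cf].
have [df dvf] := cf; split=> [x Ux|v].
  by apply: differentiableV; [exact: df|apply: f0; rewrite inE].
have cV := ih f f0 (class_CS cf).
have := class_CN (class_CM (class_CM cV cV) (dvf v)).
apply: class_C_eq => x xU; rewrite deriveV ?f0//; last first.
  by apply/diff_derivable/df; rewrite inE in xU.
by rewrite -expr2 exprVn -mulNr.
Qed.

Lemma class_C_comp n (O : set R) (f : R -> R) (p : V -> R) :
  {in U, forall x, O (p x)} -> class_C n O f -> class_C n U p ->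
  class_C n U (fun x => f (p x)).
Proof.
move=> pO; elim: n f p pO => [|n ih] f p pO.
  move=> cf cp x Ux; apply: (@continuous_comp _ _ _ p f x); first exact: cp.
  by apply: cf; apply: pO; rewrite inE.
move=> cf cp; have [df dvf] := cf; have [dp dvp] := cp; split=> [x Ux|v].
  apply: (@differentiable_comp _ _ _ _ p f x (dp x Ux)).
  by apply/df/pO; rewrite inE.
have := class_CM (dvp v) (ih _ _ pO (dvf 1) (class_CS cp)).
apply: class_C_eq => x xU; have Ux : U x by rewrite inE in xU.
rewrite (@derive_comp _ _ _ _ p f x v (dp _ Ux) (df _ (pO _ xU))).
by rewrite -['D_v p x in RHS]mulr1 [RHS]deriveZdir//; exact/df/pO.
Qed.

Lemma class_C_pair_fun n (O : set (R * R)) (f : R * R -> R) (p q : V -> R) :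
  {in U, forall x, O (p x, q x)} -> class_C n O f ->
  class_C n U p -> class_C n U q -> class_C n U (fun x => f (p x, q x)).
Proof.
move=> pO; elim: n f => [|n ih] f.
  move=> cf cp cq x Ux.
  apply: (@continuous_comp _ _ _ (fun y => (p y, q y)) f x).
    exact: cvg_pair (cp x Ux) (cq x Ux).
  by apply: cf; apply: pO; rewrite inE.
move=> cf cp cq; have [df dvf] := cf.
have [dp dvp] := cp; have [dq dvq] := cq; split=> [x Ux|v].
  apply: differentiable_pair_fun; [exact: dp|exact: dq|].
  by apply/df/pO; rewrite inE.
have := class_CD (class_CM (dvp v) (ih _ (dvf (1, 0)) (class_CS cp) (class_CS cq)))
  (class_CM (dvq v) (ih _ (dvf (0, 1)) (class_CS cp) (class_CS cq))).
apply: class_C_eq => x xU; have Ux : U x by rewrite inE in xU.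
by rewrite derive_pair_fun//; [exact: dp|exact: dq|exact/df/pO].
Qed.

End class_C_theory.

(** * Rank-two matrices and their symmetrizers *)

Section rank_two.
Variables (R : rcfType) (n : nat).
Implicit Types (u v w : 'cV[R]_n.+1) (M N : 'M[R]_n.+1).

Definition dotc u v : R := (u^T *m v) 0 0.

Lemma dotcE u v : dotc u v = \sum_i u i 0 * v i 0.
Proof. by rewrite /dotc mxE; apply: eq_bigr => i _; rewrite mxE. Qed.

Lemma dotcC u v : dotc u v = dotc v u.
Proof. by rewrite !dotcE; apply: eq_bigr => i _; rewrite mulrC. Qed.

Lemma dotcDr u v w : dotc u (v + w) = dotc u v + dotc u w.
Proof. by rewrite /dotc mulmxDr mxE. Qed.

Lemma dotcZr u v (c : R) : dotc u (c *: v) = c * dotc u v.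
Proof. by rewrite /dotc -scalemxAr mxE. Qed.

Lemma dotcBr u v w : dotc u (v - w) = dotc u v - dotc u w.
Proof. by rewrite -scaleN1r dotcDr dotcZr mulN1r. Qed.

Lemma dotc0r u : dotc u 0 = 0.
Proof. by rewrite /dotc mulmx0 mxE. Qed.

Lemma dotc_sumr (m : nat) (F : 'I_m -> 'cV[R]_n.+1) u :
  dotc u (\sum_i F i) = \sum_i dotc u (F i).
Proof. by rewrite /dotc mulmx_sumr summxE. Qed.

Lemma dotc_ge0 u : 0 <= dotc u u.
Proof. by rewrite dotcE sumr_ge0// => i _; rewrite -expr2 sqr_ge0. Qed.

Lemma dotc_eq0 u : dotc u u = 0 -> u = 0.
Proof.
rewrite dotcE => /eqP; rewrite psumr_eq0; last first.
  by move=> i _; rewrite -expr2 sqr_ge0.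
move=> /allP u0; apply/colP => i; rewrite mxE.
by have := u0 i (mem_index_enum _); rewrite mulf_eq0 orbb => /eqP.
Qed.

Lemma outer_mul u v w : u *m v^T *m w = dotc v w *: u.
Proof. by rewrite -mulmxA [v^T *m w]mx11_scalar mul_mx_scalar. Qed.

Lemma mul_outer M u v : M *m (u *m v^T) = (M *m u) *m v^T.
Proof. by rewrite mulmxA. Qed.

Lemma trmxD M N : (M + N)^T = M^T + N^T.
Proof. by rewrite raddfD. Qed.

Lemma trmxZ (c : R) M : (c *: M)^T = c *: M^T.
Proof. by rewrite linearZ. Qed.

(* [X (X^2 - l^2)] annihilates M and has simple real roots. *)
Lemma diagonalizable_cube (c l : R) M :
  l != 0 -> M *m M *m M = l ^+ 2 *: M -> diagonalizable (c%:M + M).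
Proof.
move=> l0 M3; apply/diagonalizableP; exists [:: c; c + l; c - l].
  rewrite /= !inE andbT negb_or -andbA.
  by apply/and3P; split; apply/eqP => h; move/eqP: l0; apply; lra.
apply: mxminpoly_min.
have XsubC a : horner_mx (c%:M + M) ('X - a%:P) = c%:M + M - a%:M.
  by rewrite rmorphB /= horner_mx_X horner_mx_C.
rewrite !big_cons big_nil mulr1 !rmorphM /= !XsubC.
have -> : c%:M + M - c%:M = M by rewrite addrC addKr.
have -> : c%:M + M - (c + l)%:M = M - l%:M.
  by rewrite raddfD /= opprD addrA [c%:M + M]addrC addrK.
have -> : c%:M + M - (c - l)%:M = M + l%:M.
  by rewrite raddfB /= opprB addrA [c%:M + M]addrC addrAC addrK.
have -> : (M - l%:M) * (M + l%:M) = M * M - (l ^+ 2)%:M.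
  rewrite mulrDl !mulrDr !mulNr addrA.
  by rewrite -[l%:M * M]/(l%:M *m M) -[M * l%:M]/(M *m l%:M)
    -[l%:M * l%:M]/(l%:M *m l%:M) scalar_mxC addrK -scalar_mxM expr2.
rewrite mulrBr mulrA -[M * M * M]/(M *m M *m M) M3.
by rewrite -[M * _]/(M *m _) mul_mx_scalar subrr.
Qed.

(** The rank-two part N exchanges the lines of [r] and [x]: N r = (g . r) x and N x = (d . x) r.
    Hence N^3 = (d . x)(g . r) N, with a positive factor. *)
Lemma diagonalizable_rank2 (c : R) (r d x g : 'cV[R]_n.+1) :
  dotc d r = 0 -> dotc g x = 0 -> 0 < dotc d x * dotc g r ->
  diagonalizable (c%:M + (r *m d^T + x *m g^T)).
Proof.
move=> dr gx pos; set N := r *m d^T + x *m g^T.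
apply: (@diagonalizable_cube c (Num.sqrt (dotc d x * dotc g r))).
  by rewrite gt_eqF// sqrtr_gt0.
rewrite sqr_sqrtr ?ltW//.
have Nr : N *m r = dotc g r *: x by rewrite mulmxDl !outer_mul dr scale0r add0r.
have Nx : N *m x = dotc d x *: r by rewrite mulmxDl !outer_mul gx scale0r addr0.
have N2 : N *m N = dotc g r *: (x *m d^T) + dotc d x *: (r *m g^T).
  by rewrite {2}/N mulmxDr !mulmxA Nr Nx -!scalemxAl.
rewrite -mulmxA N2 mulmxDr -!scalemxAr !mulmxA Nr Nx -!scalemxAl !scalerA.
by rewrite [dotc g r * _]mulrC -scalerDr.
Qed.
End rank_two.

Section symmetrizer.
Variables (R : realType) (n m : nat).
Variables (rho : R) (r g : 'cV[R]_n.+1) (x d : 'I_m -> 'cV[R]_n.+1).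

Definition proj_orth : 'M[R]_n.+1 := 1%:M - \sum_j x j *m (x j)^T.

(* Orthogonal projection onto the complement of the span of r and the x_j,
   when the latter are orthonormal. *)
Definition proj_scal : 'M[R]_n.+1 :=
  proj_orth - (dotc (proj_orth *m r) (proj_orth *m r))^-1 *:
    ((proj_orth *m r) *m (proj_orth *m r)^T).

(* Chosen so that H r = g and H x_j = d_j, which makes
   H (r d_j^T + x_j g^T) = g d_j^T + d_j g^T symmetric. *)
Definition symmetrizer : 'M[R]_n.+1 :=
  rho *: (\sum_j d j *m (d j)^T) + (dotc g r)^-1 *: (g *m g^T)
  + proj_scal^T *m proj_scal.

Hypotheses (rho0 : 0 < rho) (gr0 : 0 < dotc g r).
Hypothesis xx : forall i j, dotc (x i) (x j) = (i == j)%:R.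
Hypothesis dx : forall i j, dotc (d i) (x j) = (i == j)%:R / rho.
Hypothesis dr : forall j, dotc (d j) r = 0.
Hypothesis gx : forall j, dotc g (x j) = 0.

Let D := proj_orth.

Lemma proj_orth_mul v : D *m v = v - \sum_j dotc (x j) v *: x j.
Proof.
rewrite mulmxBl mul1mx mulmx_suml; congr (_ - _).
by apply: eq_bigr => j _; rewrite outer_mul.
Qed.

Let Dx j : D *m x j = 0.
Proof.
rewrite proj_orth_mul (bigD1 j)//= xx eqxx scale1r big1 ?addr0 ?subrr// => i ij.
by rewrite xx (negbTE ij) scale0r.
Qed.

Let gD v : dotc g (D *m v) = dotc g v.
Proof.
rewrite proj_orth_mul dotcBr dotc_sumr big1 ?subr0// => j _.
by rewrite dotcZr gx mulr0.
Qed.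

Let xD j v : dotc (x j) (D *m v) = 0.
Proof.
rewrite proj_orth_mul dotcBr dotc_sumr (bigD1 j)//= dotcZr xx eqxx mulr1.
by rewrite big1 ?addr0 ?subrr// => i ij; rewrite dotcZr xx eq_sym (negbTE ij) mulr0.
Qed.

Let DrDr : dotc (D *m r) (D *m r) = dotc (D *m r) r.
Proof.
rewrite {2}proj_orth_mul dotcBr dotc_sumr.
rewrite big1 ?subr0// => j _.
by rewrite dotcZr [dotc (D *m r) _]dotcC xD mulr0.
Qed.

(** [g] vanishes on every [x j] but not on [r], so [r] is not in their span. *)
Lemma proj_orth_r_neq0 : dotc (D *m r) (D *m r) != 0.
Proof.
apply/eqP => /dotc_eq0 Dr0; have := gr0.
by rewrite -gD Dr0 dotc0r ltxx.
Qed.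

Lemma proj_scal_r : proj_scal *m r = 0.
Proof.
rewrite mulmxBl -scalemxAl outer_mul scalerA -/D -DrDr mulVf ?proj_orth_r_neq0// scale1r.
exact: subrr.
Qed.

Lemma proj_scal_x j : proj_scal *m x j = 0.
Proof.
by rewrite mulmxBl -scalemxAl outer_mul -/D Dx [dotc _ (x j)]dotcC xD
  scale0r scaler0 subr0.
Qed.

Lemma symmetrizer_r : symmetrizer *m r = g.
Proof.
rewrite !mulmxDl -!scalemxAl mulmx_suml outer_mul -mulmxA proj_scal_r mulmx0.
rewrite addr0 scalerA mulVf ?gt_eqF// scale1r big1 ?scaler0 ?add0r// => j _.
by rewrite outer_mul dr scale0r.
Qed.

Lemma symmetrizer_x j : symmetrizer *m x j = d j.
Proof.
rewrite !mulmxDl -!scalemxAl mulmx_suml outer_mul -mulmxA proj_scal_x mulmx0.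
rewrite addr0 gx scale0r scaler0 addr0 (bigD1 j)//= outer_mul dx eqxx.
rewrite big1 ?addr0; last by move=> i ij; rewrite outer_mul dx (negbTE ij) mul0r scale0r.
by rewrite scalerA mul1r divff ?gt_eqF// scale1r.
Qed.

Lemma symmetrizer_sym : symmetrizer^T = symmetrizer.
Proof.
have dE : (\sum_j d j *m (d j)^T)^T = \sum_j d j *m (d j)^T.
  by rewrite raddf_sum; apply: eq_bigr => j _; rewrite /= trmx_mul trmxK.
by rewrite /symmetrizer; move: proj_scal => P; rewrite !trmxD !trmxZ dE !trmx_mul !trmxK.
Qed.

Lemma symmetrizer_quad v :
  dotc v (symmetrizer *m v) = rho * (\sum_j dotc (d j) v ^+ 2)
    + (dotc g r)^-1 * dotc g v ^+ 2 + dotc (proj_scal *m v) (proj_scal *m v).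
Proof.
rewrite /symmetrizer; move: proj_scal => P.
rewrite !mulmxDl !dotcDr -!scalemxAl !dotcZr outer_mul dotcZr mulmx_suml dotc_sumr.
congr (_ * _ + _ * _ + _).
- by apply: eq_bigr => j _; rewrite outer_mul dotcZr [dotc v _]dotcC.
- by rewrite [dotc v _]dotcC.
- by rewrite /dotc trmx_mul !mulmxA.
Qed.

(** A null vector v of this sum of squares is killed by [g], by all [d j] and by [proj_scal]. The
    last puts v in the span of [r] and the [x j]; then g . r > 0 with g . x_j = 0 removes the part
    along [r], and d_i . x_j = delta_ij / rho removes the rest. *)
Lemma symmetrizer_posdef : posdef symmetrizer.
Proof.
split=> [|v v0].
  by apply/is_hermitianmxP; rewrite expr0 scale1r map_mx_id// symmetrizer_sym.
have -> : (v^T *m symmetrizer *m v) 0 0 = dotc v (symmetrizer *m v).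
  by rewrite /dotc mulmxA.
rewrite symmetrizer_quad.
set a := rho * _; set b := _^-1 * _; set c := dotc _ _.
have a0 : 0 <= a by apply: mulr_ge0; [exact: ltW|apply: sumr_ge0 => j _; exact: sqr_ge0].
have b0 : 0 <= b by rewrite mulr_ge0 ?sqr_ge0// invr_ge0 ltW.
have c0 : 0 <= c by exact: dotc_ge0.
rewrite lt_neqAle !addr_ge0// andbT eq_sym; apply: contra v0.
rewrite paddr_eq0 ?addr_ge0// paddr_eq0// => /andP[/andP[/eqP aE /eqP bE] /eqP cE].
have gv0 : dotc g v = 0.
  by move/eqP: bE; rewrite mulf_eq0 invr_eq0 gt_eqF//= sqrf_eq0 => /eqP.
have dv0 j : dotc (d j) v = 0.
  move/eqP: aE; rewrite mulf_eq0 gt_eqF//= psumr_eq0; last by move=> i _; exact: sqr_ge0.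
  by move=> /allP/(_ j (mem_index_enum _)); rewrite sqrf_eq0 => /eqP.
have := dotc_eq0 cE; rewrite mulmxBl -scalemxAl outer_mul scalerA -/D.
set t := _ * _ => /subr0_eq Dv.
have t0 : t = 0.
  have := gv0; rewrite -gD Dv dotcZr gD => /eqP.
  by rewrite mulf_eq0 [dotc g r == 0]gt_eqF// orbF => /eqP.
have := proj_orth_mul v; rewrite Dv t0 scale0r => /esym/subr0_eq vE.
have dvE j : dotc (d j) v = dotc (x j) v / rho.
  rewrite {1}vE dotc_sumr (bigD1 j)//= big1 => [|i ij]; last first.
    by rewrite dotcZr dx eq_sym (negbTE ij) mul0r mulr0.
  by rewrite addr0 dotcZr dx eqxx mul1r.
rewrite vE big1// => j _.
have /eqP := dv0 j; rewrite dvE mulf_eq0 invr_eq0 [rho == 0]gt_eqF//.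
by rewrite orbF => /eqP ->; rewrite scale0r.
Qed.

Lemma symmetrizer_mul_sym (c : R) j :
  (symmetrizer *m (c%:M + (r *m (d j)^T + x j *m g^T)))^T =
  symmetrizer *m (c%:M + (r *m (d j)^T + x j *m g^T)).
Proof.
rewrite !mulmxDr !mul_outer symmetrizer_r symmetrizer_x mul_mx_scalar.
rewrite !trmxD trmxZ symmetrizer_sym !trmx_mul !trmxK.
by rewrite [g *m _ + _]addrC.
Qed.
End symmetrizer.

(** * Second derivatives of convex functions *)

(** If [l < 0], then [df] lies below [df 0] just right of 0 and above it just left. The mean value
    theorem on both sides gives f(h) + f(-h) - 2 f(0) = h (df c - df d) < 0 with d < 0 < c, against
    the midpoint inequality. Only the derivative of [df] at the single point 0 enters. *)
Lemma convex_derive2_ge0 (R : realType) (f df : R -> R) (l : R) :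
  (\forall t \near (0 : R), is_derive (t : R) (1 : R) f (df t)) ->
  is_derive (0 : R) (1 : R) df l ->
  (\forall t \near (0 : R), f 0 + f 0 <= f t + f (- t)) -> 0 <= l.
Proof.
move=> fdf [ddf dfl] fmid; rewrite leNgt; apply/negP => l0.
have slope : \forall t \near (0 : R)^', t^-1 * (df t - df 0) < 0.
  have /cvgrPdist_lt/(_ (- l)) := ddf.
  rewrite oppr_gt0 => /(_ l0); apply: filterS => t /=.
  rewrite addr0 [t *: 1]mulr1 -[lim _]/('D_1 df 0) dfl.
  by rewrite ltr_distlC subrr => /andP[_].
have [e /= e0 He] : exists2 e : R, 0 < e & forall t, `|t| < e ->
    [/\ is_derive (t : R) (1 : R) f (df t), t != 0 -> t^-1 * (df t - df 0) < 0
      & f 0 + f 0 <= f t + f (- t)].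
  have : \forall t \near (0 : R), [/\ is_derive (t : R) (1 : R) f (df t),
      t != 0 -> t^-1 * (df t - df 0) < 0 & f 0 + f 0 <= f t + f (- t)].
    have slope0 : \forall t \near (0 : R), t != 0 -> t^-1 * (df t - df 0) < 0 :=
      slope.
    by apply: filterS3 fdf slope0 fmid => t.
  move=> /nbhs_normP[e /= e0 He]; exists e => // t te; apply: He.
  by rewrite /= sub0r normrN.
pose h := e / 2.
have h0 : 0 < h by rewrite /h divr_gt0.
have he : h < e by rewrite /h ltr_pdivrMr// ltr_pMr// ltr1n.
have cont a b : - h <= a -> b <= h -> {within `[a, b], continuous f}.
  move=> ha bh; apply: derivable_within_continuous => t.
  rewrite in_itv /= => /andP[at_ tb].
  have [|[]//] := He t; rewrite (le_lt_trans _ he)// ler_norml.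
  by rewrite (le_trans ha at_) (le_trans tb bh).
have small a b t : - h <= a -> b <= h -> t \in `]a, b[%R -> `|t| < e.
  move=> ha bh; rewrite in_itv /= => /andP[at_ tb].
  by rewrite (lt_trans _ he)// ltr_norml (le_lt_trans ha at_) (lt_le_trans tb bh).
have h0w := ltW h0; have Nh0 : - h <= 0 by rewrite oppr_le0.
have [c ch fh] : exists2 c, c \in `]0, h[%R & f h - f 0 = df c * (h - 0).
  apply: (@MVT _ f df _ _ h0) => [t tI|]; last exact: cont.
  by have [] := He t (small 0 h t Nh0 (lexx h) tI).
have [d dh fNh] : exists2 d, d \in `](- h), 0[%R & f 0 - f (- h) = df d * (0 - - h).
  apply: (@MVT _ f df) => [|t tI|]; last exact: cont.
  - by rewrite oppr_lt0.
  - by have [] := He t (small (- h) 0 t (lexx _) h0w tI).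
have dfc : df c < df 0.
  have [_ + _] := He c (small 0 h c Nh0 (lexx h) ch).
  move: ch; rewrite in_itv /= => /andP[c0 _]; rewrite gt_eqF// => /(_ isT).
  by rewrite pmulr_rlt0 ?invr_gt0// subr_lt0.
have dfd : df 0 < df d.
  have [_ + _] := He d (small (- h) 0 d (lexx _) h0w dh).
  move: dh; rewrite in_itv /= => /andP[_ d0]; rewrite lt_eqF// => /(_ isT).
  by rewrite nmulr_rlt0 ?invr_lt0// subr_gt0.
have [|_ _] := He h; first by rewrite gtr0_norm.
have : h * df c < h * df d by rewrite ltr_pM2l// (lt_trans dfc).
by move: fh fNh; rewrite !subr0 sub0r opprK; lra.
Qed.

(** * Perspectives of the energies along affine lines *)

Section perspective.
Variable R : realType.
Implicit Types (f : R * R -> R) (p q : R -> R).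

Lemma is_derive_pair_fun f p q (t dp dq : R) :
  is_derive t (1 : R) p dp -> is_derive t (1 : R) q dq ->
  differentiable f (p t, q t) ->
  is_derive t (1 : R) (fun t => f (p t, q t))
    (dp * 'D_((1, 0) : R * R) f (p t, q t) + dq * 'D_((0, 1) : R * R) f (p t, q t)).
Proof.
move=> [/derivable1_diffP dp' <-] [/derivable1_diffP dq' <-] df; split.
  by apply/derivable1_diffP; exact: differentiable_pair_fun.
by rewrite derive_pair_fun.
Qed.

Lemma is_derive_affine (a b t : R) :
  is_derive t (1 : R) (fun t => a + b * t) b.
Proof.
have : is_derive t (1 : R) (cst a + b \*: (@id R)) (0 + b *: (1 : R)).
  exact: is_deriveD.
by rewrite add0r [_ *: _]mulr1.
Qed.

Lemma is_deriveM1 p q (t dp dq : R) :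
  is_derive t (1 : R) p dp -> is_derive t (1 : R) q dq ->
  is_derive t (1 : R) (fun t => p t * q t) (dp * q t + p t * dq).
Proof.
move=> hp hq; have : is_derive t (1 : R) (p * q) (p t *: dq + q t *: dp).
  exact: is_deriveM.
by rewrite addrC [q t *: dp]mulrC.
Qed.

Lemma is_deriveD1 p q (t dp dq : R) :
  is_derive t (1 : R) p dp -> is_derive t (1 : R) q dq ->
  is_derive t (1 : R) (fun t => p t + q t) (dp + dq).
Proof. by move=> hp hq; exact: is_deriveD. Qed.

Lemma is_derive_quotient p q (t dp dq : R) : q t != 0 ->
  is_derive t (1 : R) p dp -> is_derive t (1 : R) q dq ->
  is_derive t (1 : R) (fun t => p t / q t) ((dp - p t / q t * dq) / q t).
Proof.
move=> qt0 hp hq.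
have hV : is_derive t (1 : R) (fun t => (q t)^-1) (- (q t) ^- 2 *: dq).
  by case: hq => hq <-; split; [exact: derivableV|rewrite deriveV].
apply: is_derive_eq (is_deriveM1 hp hV) _.
by rewrite /GRing.scale /=; field.
Qed.

Variables (f : R * R -> R) (q0 q1 a0 a1 s0 s1 : R).
Hypotheses (cf : class_C 2 [set p : R * R | 0 < p.1] f) (q0_gt0 : 0 < q0)
  (a0_gt0 : 0 < a0).

Let q t := q0 + q1 * t.
Let tau t := (a0 + a1 * t) / q t.
Let s t := s0 + s1 * t.
Let f_t := 'D_((1, 0) : R * R) f.
Let f_s := 'D_((0, 1) : R * R) f.

(** Mass times specific energy, with mass [q], volume [a0 + a1 * t] and entropy [s] all affine in t:
    the perspective of [f] in its first argument only. The entropy stays per unit mass, which is why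
    a first derivative, [2 * q1 * s1 * f_s], remains in the second derivative at 0. *)
Definition perspective (t : R) : R := q t * f (tau t, s t).

Definition perspective' (t : R) : R :=
  q1 * f (tau t, s t) + (a1 - tau t * q1) * f_t (tau t, s t)
  + q t * (s1 * f_s (tau t, s t)).

Lemma is_derive_perspective t : 0 < q0 + q1 * t -> 0 < a0 + a1 * t ->
  is_derive t (1 : R) perspective (perspective' t).
Proof.
move=> qt' at_; have qt : 0 < q t := qt'; have [df _] := cf.
have dtau := is_derive_quotient (lt0r_neq0 qt) (is_derive_affine a0 a1 t)
  (is_derive_affine q0 q1 t).
apply: is_derive_eq (is_deriveM1 (is_derive_affine q0 q1 t)
  (is_derive_pair_fun dtau (is_derive_affine s0 s1 t) _)) _.
  by apply: df; rewrite /= divr_gt0.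
rewrite /perspective' -/(q t) -/(tau t) -/(s t) /f_t /f_s /=.
have qt0 := lt0r_neq0 qt; by field.
Qed.

(** Since tau' = (a1 - tau q1) / q, the rate of the specific volume at 0 is [b / q0]. In the term
    [f_t], the first derivatives cancel because (a1 - tau q1)' = - q1 tau'. *)
Lemma is_derive_perspective' (tau0 := a0 / q0) (b := a1 - tau0 * q1) :
  is_derive (0 : R) (1 : R) perspective'
    (b ^+ 2 / q0 * 'D_((1, 0) : R * R) f_t (tau0, s0)
     + 2 * q1 * s1 * f_s (tau0, s0)
     + b * s1 * ('D_((1, 0) : R * R) f_s (tau0, s0)
                 + 'D_((0, 1) : R * R) f_t (tau0, s0))
     + q0 * s1 ^+ 2 * 'D_((0, 1) : R * R) f_s (tau0, s0)).
Proof.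
have [df dvf] := cf; have [dft _] := dvf (1, 0); have [dfs _] := dvf (0, 1).
have qE : q 0 = q0 by rewrite /q mulr0 addr0.
have tauE : tau 0 = tau0 by rewrite /tau qE mulr0 addr0.
have sE : s 0 = s0 by rewrite /s mulr0 addr0.
have tau_gt0 : 0 < tau 0 by rewrite tauE divr_gt0.
have q0_neq0 : q 0 != 0 by rewrite qE gt_eqF.
have dq := is_derive_affine q0 q1 0; have ds := is_derive_affine s0 s1 0.
have dtau := is_derive_quotient q0_neq0 (is_derive_affine a0 a1 0) dq.
have dF := is_derive_pair_fun dtau ds (df (tau 0, s 0) tau_gt0).
have dFt := is_derive_pair_fun dtau ds (dft (tau 0, s 0) tau_gt0).
have dFs := is_derive_pair_fun dtau ds (dfs (tau 0, s 0) tau_gt0).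
have db : is_derive (0 : R) (1 : R) (fun t => a1 - tau t * q1)
    (0 - ((a1 - tau0 * q1) / q0 * q1 + tau0 * 0)).
  apply: is_deriveB; rewrite -tauE -qE.
  exact: is_deriveM1 dtau (is_derive_cst _ _ _).
have := is_deriveD1 (is_deriveD1
  (is_deriveM1 (is_derive_cst q1 (0 : R) (1 : R)) dF) (is_deriveM1 db dFt))
  (is_deriveM1 dq (is_deriveM1 (is_derive_cst s1 (0 : R) (1 : R)) dFs)).
move/is_derive_eq; apply.
rewrite -/(q 0) -/(tau 0) -/(s 0) qE tauE sE /f_t /f_s /b /=.
have algebra (z zt zs ztt zts zst zss : R) :
    0 * z + q1 * ((a1 - tau0 * q1) / q0 * zt + s1 * zs)
    + ((0 - ((a1 - tau0 * q1) / q0 * q1 + tau0 * 0)) * zt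
       + (a1 - tau0 * q1) * ((a1 - tau0 * q1) / q0 * ztt + s1 * zts))
    + (q1 * (s1 * zs)
       + q0 * (0 * zs + s1 * ((a1 - tau0 * q1) / q0 * zst + s1 * zss))) =
    (a1 - tau0 * q1) ^+ 2 / q0 * ztt + 2 * q1 * s1 * zs
    + (a1 - tau0 * q1) * s1 * (zst + zts) + q0 * s1 ^+ 2 * zss.
  by move: (tau0) => x; field; exact: lt0r_neq0.
exact: algebra.
Qed.

End perspective.

Lemma affine_ge0_slope0 (R : realFieldType) (p q : R) :
  (forall a, 0 <= a * p + q) -> p = 0.
Proof.
move=> h; apply/eqP/negPn/negP => p0; have := h (- (q + 1) / p).
by rewrite divfK//; lra.
Qed.

(* Q is the second derivative of the energy along [dir]: f1 and f2 stand for
   d^2 e_k / d tau_k^2, X for the sum of the mixed derivatives of e_1, T and h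
   for d e_1 / d s_1 and d^2 e_1 / d s_1^2, and e for e_i''. *)
Lemma second_variation_gt0 (R : realFieldType)
    (B A1 A2 A3 t1 t2 f1 f2 T X h e sig rho : R)
    (Q := fun a b c d => B * a ^+ 2
      + ((b - t1 * (A1 * a)) ^+ 2 / A1 * f1 + 2 * (A1 * a) * c * T
         + (b - t1 * (A1 * a)) * c * X + A1 * c ^+ 2 * h)
      + (- b - t2 * (A2 * a)) ^+ 2 / A2 * f2
      + A3 * (rho * (a * sig + d) / A3) ^+ 2 * e) :
  0 <= B -> 0 < A1 -> 0 < A2 -> 0 < A3 -> 0 < t1 -> 0 < t2 -> 0 < T -> 0 < rho ->
  (forall a b c d, a * d = 0 -> 0 <= Q a b c d) -> 0 < Q 1 0 0 0.
Proof.
move=> B0 A10 A20 A30 t10 t20 T0 rho0 Q0.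
rewrite lt_neqAle Q0 ?mulr0// andbT; apply/eqP => /esym Q1.
have A1n := lt0r_neq0 A10; have A2n := lt0r_neq0 A20; have A3n := lt0r_neq0 A30.
have Q1E : Q 1 0 0 0 =
    B + t1 ^+ 2 * A1 * f1 + t2 ^+ 2 * A2 * f2 + (rho * sig) ^+ 2 / A3 * e.
  by rewrite /Q; field; rewrite A1n A2n A3n.
(* The coefficient of a^2 is [Q 1 0 0 0], assumed to vanish, so [Q a 1 0 0] is affine in a;
   nonnegative for all a, it has slope 0. This is the mechanical balance [t12]. *)
have Q2 a : 0 <= a * (2 * (t2 * f2 - t1 * f1)) + (f1 / A1 + f2 / A2).
  have := Q0 a 1 0 0 (mulr0 a).
  suff -> : Q a 1 0 0 = a ^+ 2 * Q 1 0 0 0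
      + (a * (2 * (t2 * f2 - t1 * f1)) + (f1 / A1 + f2 / A2)).
    by rewrite Q1 mulr0 add0r.
  by rewrite /Q; field; rewrite A1n A2n A3n.
have e0 : 0 <= e.
  have := Q0 0 0 0 1 (mul0r 1).
  have -> : Q 0 0 0 1 = rho ^+ 2 / A3 * e.
    by rewrite /Q; field; rewrite A1n A2n A3n.
  by rewrite pmulr_rge0// divr_gt0// exprn_gt0.
have t12 : t2 * f2 = t1 * f1.
  by have := affine_ge0_slope0 Q2; lra.
(* By [t12], the constant term f1 / A1 + f2 / A2 of [Q2] is a positive multiple of [f1]. *)
have f10 : 0 <= f1.
  have := Q2 0; rewrite mul0r add0r.
  have -> : f2 = t1 / t2 * f1.
    by apply: (mulfI (lt0r_neq0 t20)); rewrite t12; field; exact: lt0r_neq0.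
  rewrite [_ / _ * f1]mulrC -mulrA -mulrDr mulrC pmulr_rge0//.
  by rewrite addr_gt0// ?invr_gt0// !divr_gt0.
have f20 : 0 <= f2.
  by have := mulr_ge0 (ltW t10) f10; rewrite -t12 pmulr_rge0.
have x0 : 0 <= t1 ^+ 2 * A1 * f1 by rewrite !mulr_ge0// ?sqr_ge0 ?ltW.
have y0 : 0 <= t2 ^+ 2 * A2 * f2 by rewrite !mulr_ge0// ?sqr_ge0 ?ltW.
have z0 : 0 <= (rho * sig) ^+ 2 / A3 * e.
  by apply: mulr_ge0 e0; rewrite divr_ge0 ?sqr_ge0 ?ltW.
(* [Q1E] now writes 0 as a sum of four nonnegative terms. *)
have f1E : f1 = 0.
  have : t1 ^+ 2 * A1 * f1 = 0 by move: Q1; rewrite Q1E; lra.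
  by move/eqP; rewrite !mulf_eq0 (negbTE A1n) (gt_eqF t10) => /eqP.
have f2E : f2 = 0.
  have : t2 ^+ 2 * A2 * f2 = 0 by move: Q1; rewrite Q1E; lra.
  by move/eqP; rewrite !mulf_eq0 (negbTE A2n) (gt_eqF t20) => /eqP.
(* Without [f1] and [f2] the form is affine in b as well. The slope in b gives X = 0, after which
   the slope in a is 2 A1 T, which cannot vanish. *)
have Q3 a b : 0 <= a * (2 * A1 * T - t1 * A1 * X) + (b * X + A1 * h).
  have := Q0 a b 1 0 (mulr0 a).
  suff -> : Q a b 1 0 = a ^+ 2 * Q 1 0 0 0
      + (a * (2 * A1 * T - t1 * A1 * X) + (b * X + A1 * h)).
    by rewrite Q1 mulr0 add0r.
  by rewrite /Q f1E f2E; field; rewrite A1n A2n A3n.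
have X0 : X = 0.
  by apply: (@affine_ge0_slope0 _ _ (A1 * h)) => b; have := Q3 0 b; rewrite mul0r add0r.
have := affine_ge0_slope0 (Q3^~ 0).
rewrite X0 mulr0 subr0 => /eqP; rewrite !mulf_eq0 (negbTE A1n) (gt_eqF T0).
by rewrite pnatr_eq0.
Qed.

(** * The energy as a function of the state *)

Section state_space.
Variable R : realType.
Implicit Types (w v : state R).

Definition base (i : 'I_12) : state R := delta_mx i 0.

Definition iK (j : 'I_3) : 'I_12 := rshift 1 (lshift 8 j).

Lemma iK_inj : injective iK.
Proof. by move=> i j /(congr1 val)/= ij; apply/val_inj/(@addnI 1). Qed.

Lemma w_KE w j : w_K w 0 j = w (iK j) 0.
Proof. by rewrite mxE. Qed.

Lemma w_uE w j : w_u w 0 j = w (iK j) 0 / w_rho w.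
Proof. by rewrite mxE w_KE mulrC. Qed.

Lemma state_sum v : v = \sum_i v i 0 *: base i.
Proof.
apply/colP => i; rewrite summxE (bigD1 i)//= big1 => [|k ki].
  by rewrite !mxE !eqxx mulr1 addr0.
by rewrite !mxE eq_sym (negbTE ki) mulr0.
Qed.

Lemma differentiable_state_coord i w :
  differentiable (fun w' : state R => w' i 0) w.
Proof. exact: differentiable_coord. Qed.

Lemma derive_coord i v w : 'D_v (fun w' : state R => w' i 0) w = v i 0.
Proof.
have := @derive_mx _ _ _ _ (@id (state R)) w v (@derivable_id _ _ w v).
by rewrite derive_id => /matrixP/(_ i 0) ->; rewrite mxE.
Qed.

Lemma class_C_state_coord n (U : set (state R)) i :
  open U -> class_C n U (fun w => w i 0).
Proof.
move=> oU; case: n => [|n] /=.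
  by move=> w _; apply: differentiable_continuous (differentiable_state_coord i w).
split=> [w _|v]; first exact: differentiable_state_coord.
by apply: (class_C_eq oU _ (class_C_cst oU n (v i 0))) => w _; rewrite derive_coord.
Qed.

Lemma open_coord_gt i (c : R) : open [set w : state R | c < w i 0].
Proof.
apply: (@open_comp _ _ (fun w : state R => w i 0) [set x | c < x]).
  by move=> w _; exact: coord_continuous.
exact: open_gt.
Qed.

Lemma open_coord_lt i (c : R) : open [set w : state R | w i 0 < c].
Proof.
apply: (@open_comp _ _ (fun w : state R => w i 0) [set x | x < c]).
  by move=> w _; exact: coord_continuous.
exact: open_lt.
Qed.

Lemma open_admissible : open (@admissible R).
Proof.
have -> : @admissible R = [set w | 0 < w_rho w] `&`
    ([set w | 0 < w_y w] `&` [set w | w_y w < 1]) `&`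
    ([set w | 0 < w_al w] `&` [set w | w_al w < 1]) `&` [set w | 0 < w_a w].
  apply/seteqP; split=> w /=.
    by move=> [? /andP[? ?] /andP[? ?] ?].
  by move=> [[[? [? ?]] [? ?]] ?]; split=> //; apply/andP.
by do ![apply: openI]; (exact: open_coord_gt || exact: open_coord_lt).
Qed.

End state_space.

Section energy.
Variables (R : realType) (X : two_phase_model R).
Implicit Types (w v : state R).

Lemma rho_mixture_energyE rho s s1 s2 a y al : rho != 0 ->
  rho * mixture_energy X rho s s1 s2 a y al =
    y * rho * e1 X (al / (y * rho), s1)
    + (1 - y) * rho * e2 X ((1 - al) / ((1 - y) * rho), s2)
    + a * ei X (rho * (s - y * s1 - (1 - y) * s2) / a).
Proof. by move=> rho0; rewrite /mixture_energy; field. Qed.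

Hypotheses (hm : 0 < inertia_m X) (hnu : 0 < inertia_nu X).

Lemma total_energyE w : w_rho w != 0 -> total_energy X w =
  2^-1 * (w_rho w)^-1 * dot3 (w_K w) (w_K w)
  + (2 * inertia_m X)^-1 * (w_M w * w_M w)
  + (2 * inertia_nu X)^-1 * (w_P w * w_P w)
  + (w_y w * w_rho w * e1 X (w_al w / (w_y w * w_rho w), w_s1 w)
    + (1 - w_y w) * w_rho w
        * e2 X ((1 - w_al w) / ((1 - w_y w) * w_rho w), w_s2 w)
    + w_a w * ei X (w_rho w * (w_s w - w_y w * w_s1 w - (1 - w_y w) * w_s2 w)
                    / w_a w)).
Proof.
move=> rho0; rewrite -rho_mixture_energyE// /total_energy /L_at /lagrangian.
have -> : dot3 (w_u w) (w_K w) = (w_rho w)^-1 * dot3 (w_K w) (w_K w).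
  by rewrite /dot3 mulr_sumr; apply: eq_bigr => j _; rewrite !mxE mulrA.
have -> : dot3 (w_u w) (w_u w) = (w_rho w)^-1 ^+ 2 * dot3 (w_K w) (w_K w).
  by rewrite /dot3 mulr_sumr; apply: eq_bigr => j _; rewrite !mxE; ring.
rewrite /w_dal /w_da; move: (mixture_energy _ _ _ _ _ _ _ _) (dot3 _ _) => E k.
by field; rewrite rho0 !lt0r_neq0.
Qed.

Hypothesis he1 : class_C 2 [set p : R * R | 0 < p.1] (e1 X).
Hypothesis he2 : class_C 2 [set p : R * R | 0 < p.1] (e2 X).
Hypothesis hei : class_C 2 [set: R] (ei X).

Lemma total_energy_C2 : class_C 2 (@admissible R) (total_energy X).
Proof.
have oA := @open_admissible R.
have coord i : class_C 2 (@admissible R) (fun w => w i 0).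
  exact: class_C_state_coord.
have cst c := class_C_cst oA 2 (c : R).
have rho0 w : w \in @admissible R -> w_rho w != 0.
  by rewrite inE => -[/lt0r_neq0].
have y0 w : w \in @admissible R -> w_y w != 0.
  by rewrite inE => -[_ /andP[/lt0r_neq0]].
have y1 w : w \in @admissible R -> 1 - w_y w != 0.
  by rewrite inE => -[_ /andP[_ y1] _ _]; rewrite subr_eq0 gt_eqF.
have a0 w : w \in @admissible R -> w_a w != 0.
  by rewrite inE => -[_ _ _ /lt0r_neq0].
apply: (class_C_eq oA (f := fun w => _)) => [w wA|].
  by rewrite total_energyE// rho0.
have cD := class_CD oA; have cM := class_CM oA; have cN := class_CN oA.
have cB f g (cf : class_C 2 (@admissible R) f) (cg : class_C 2 (@admissible R) g) :
  class_C 2 (@admissible R) (fun w => f w - g w) := cD _ _ _ cf (cN _ _ cg).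
have crho : class_C 2 (@admissible R) (@w_rho R) := coord _.
have cy : class_C 2 (@admissible R) (@w_y R) := coord _.
have c1y := cB _ _ (cst 1) cy.
have cal : class_C 2 (@admissible R) (@w_al R) := coord _.
have cai : class_C 2 (@admissible R) (@w_a R) := coord _.
have cM_ : class_C 2 (@admissible R) (@w_M R) := coord _.
have cP : class_C 2 (@admissible R) (@w_P R) := coord _.
have cs : class_C 2 (@admissible R) (@w_s R) := coord _.
have cs1 : class_C 2 (@admissible R) (@w_s1 R) := coord _.
have cs2 : class_C 2 (@admissible R) (@w_s2 R) := coord _.
have crhoV := class_CV oA rho0 crho.
have cK : class_C 2 (@admissible R) (fun w => dot3 (w_K w) (w_K w)).
  have cj (j : 'I_3) : class_C 2 (@admissible R) (fun w : state R => w_K w 0 j).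
    by apply: (class_C_eq oA _ (coord (iK j))) => w _; rewrite w_KE.
  exact: (@class_C_sum _ _ _ oA 2 3 _ (fun j => cM _ _ _ (cj j) (cj j))).
have q1 := cM _ _ _ cy crho.
have q2 := cM _ _ _ c1y crho.
have q10 w : w \in @admissible R -> w_y w * w_rho w != 0.
  by move=> wA; rewrite mulf_neq0 ?y0 ?rho0.
have q20 w : w \in @admissible R -> (1 - w_y w) * w_rho w != 0.
  by move=> wA; rewrite mulf_neq0 ?y1 ?rho0.
have tau1 := cM _ _ _ cal (class_CV oA q10 q1).
have tau2 := cM _ _ _ (cB _ _ (cst 1) cal) (class_CV oA q20 q2).
have sig := cB _ _ (cB _ _ cs (cM _ _ _ cy cs1)) (cM _ _ _ c1y cs2).
have si := cM _ _ _ (cM _ _ _ crho sig) (class_CV oA a0 cai).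
have E1 := class_C_pair_fun oA _ he1 tau1 cs1.
have E2 := class_C_pair_fun oA _ he2 tau2 cs2.
have E3 := class_C_comp oA _ hei si.
apply: cD _ _ _ (cD _ _ _ (cD _ _ _ (cM _ _ _ (cM _ _ _ (cst _) crhoV) cK)
    (cM _ _ _ (cst _) (cM _ _ _ cM_ cM_))) (cM _ _ _ (cst _) (cM _ _ _ cP cP)))
  (cD _ _ _ (cD _ _ _ (cM _ _ _ q1 (E1 _)) (cM _ _ _ q2 (E2 _)))
    (cM _ _ _ cai (E3 _))) => [w|w|w]; last by [].
- rewrite inE /= => -[? /andP[? _] /andP[? _] _].
  by rewrite divr_gt0// mulr_gt0.
- rewrite inE /= => -[? /andP[_ ?] /andP[_ ?] _].
  by rewrite divr_gt0 ?mulr_gt0// subr_gt0.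
Qed.

End energy.

(** * The energy along the lines of the second variation *)

Section lines.
Variables (R : realType) (X : two_phase_model R).
Implicit Types (w v : state R).

(* Density and momenta (rho, K, M, P): the components of the state which are
   stretched by the divergence of the velocity. *)
Definition stretch w : state R := \col_i (if (i < 6)%N then w i 0 else 0).

(* Along [w + t dir w a b c d], u and y are constant; rho, alpha, s_1 and, if
   [a * d = 0], rho (s - y s_1 - (1 - y) s_2) are affine functions of t. *)
Definition dir w (a b c d : R) : state R :=
  a *: stretch w + b *: base R (@Ordinal 12 6 isT)
  + (c * w_y w + d) *: base R (@Ordinal 12 8 isT) + c *: base R (@Ordinal 12 9 isT).

Section coordinates.
Variables (w : state R) (a b c d t : R).
Let wt := w + t *: dir w a b c d.

Lemma dir_rho : w_rho wt = (1 + a * t) * w_rho w.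
Proof. by rewrite /w_rho !mxE /=; ring. Qed.
Lemma dir_K : w_K wt = (1 + a * t) *: w_K w.
Proof.
by apply/rowP => -[[|[|[|j]]] lt] //; rewrite !mxE /=; ring.
Qed.
Lemma dir_M : w_M wt = (1 + a * t) * w_M w.
Proof. by rewrite /w_M !mxE /=; ring. Qed.
Lemma dir_P : w_P wt = (1 + a * t) * w_P w.
Proof. by rewrite /w_P !mxE /=; ring. Qed.
Lemma dir_al : w_al wt = w_al w + b * t.
Proof. by rewrite /w_al !mxE /=; ring. Qed.
Lemma dir_a : w_a wt = w_a w.
Proof. by rewrite /w_a !mxE /=; ring. Qed.
Lemma dir_s : w_s wt = w_s w + (c * w_y w + d) * t.
Proof. by rewrite /w_s !mxE /=; ring. Qed.
Lemma dir_s1 : w_s1 wt = w_s1 w + c * t.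
Proof. by rewrite /w_s1 !mxE /=; ring. Qed.
Lemma dir_s2 : w_s2 wt = w_s2 w.
Proof. by rewrite /w_s2 !mxE /=; ring. Qed.
Lemma dir_y : w_y wt = w_y w.
Proof. by rewrite /w_y !mxE /=; ring. Qed.

Lemma stretch_dir : stretch wt = (1 + a * t) *: stretch w.
Proof.
apply/colP => i; rewrite !mxE.
by case: i => -[|[|[|[|[|[|i]]]]]] lt; rewrite /= ?mulr0//; ring.
Qed.
End coordinates.

(** Entropy carried by the interface, per unit mass of mixture. *)
Definition sigma w : R := w_s w - w_y w * w_s1 w - (1 - w_y w) * w_s2 w.

(** Twice the kinetic energy of alpha and a_i, m |D_t alpha|^2 + nu |D_t a_i|^2. *)
Definition kinetic2 w : R :=
  w_M w * w_M w / inertia_m X + w_P w * w_P w / inertia_nu X.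

(** With rho and K scaled by the same factor, |K|^2 / (2 rho) is affine in t, whereas the energies
    of M and P are quadratic. The interface is written as a perspective too, of constant mass a_i
    and with a dummy first argument 1 / a_i, so that the same derivative lemmas cover all three
    energies. *)
Definition line_energy w (a b c d t : R) : R :=
  (1 + a * t) * (2^-1 * (w_rho w)^-1 * dot3 (w_K w) (w_K w))
  + (1 + a * t) ^+ 2 * (kinetic2 w / 2)
  + perspective (e1 X) (w_y w * w_rho w) (w_y w * w_rho w * a) (w_al w) b
      (w_s1 w) c t
  + perspective (e2 X) ((1 - w_y w) * w_rho w) ((1 - w_y w) * w_rho w * a)
      (1 - w_al w) (- b) (w_s2 w) 0 t
  + perspective (fun p => ei X p.2) (w_a w) 0 1 0
      (w_rho w * sigma w / w_a w) (w_rho w * (a * sigma w + d) / w_a w) t.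

Hypotheses (hm : 0 < inertia_m X) (hnu : 0 < inertia_nu X).

Lemma total_energy_dir w a b c d t :
  admissible w -> a * d = 0 -> 1 + a * t != 0 ->
  total_energy X (w + t *: dir w a b c d) = line_energy w a b c d t.
Proof.
move=> [/lt0r_neq0 rho0 _ _ /lt0r_neq0 a0] ad0 at0.
rewrite total_energyE// dir_rho ?mulf_neq0//.
rewrite dir_K dir_M dir_P dir_al dir_a dir_s dir_s1 dir_s2 dir_y.
have -> : dot3 ((1 + a * t) *: w_K w) ((1 + a * t) *: w_K w) =
    (1 + a * t) ^+ 2 * dot3 (w_K w) (w_K w).
  by rewrite /dot3 mulr_sumr; apply: eq_bigr => j _; rewrite !mxE; ring.
have q1E : w_y w * ((1 + a * t) * w_rho w) =
    w_y w * w_rho w + w_y w * w_rho w * a * t by ring.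
have q2E : (1 - w_y w) * ((1 + a * t) * w_rho w) =
    (1 - w_y w) * w_rho w + (1 - w_y w) * w_rho w * a * t by ring.
have siE : (1 + a * t) * w_rho w * (w_s w + (c * w_y w + d) * t
      - w_y w * (w_s1 w + c * t) - (1 - w_y w) * w_s2 w) / w_a w =
    w_rho w * sigma w / w_a w + w_rho w * (a * sigma w + d) / w_a w * t.
  apply/eqP; rewrite -subr_eq0; apply/eqP.
  transitivity (a * d * (w_rho w * t ^+ 2 / w_a w)); last by rewrite ad0 mul0r.
  by rewrite /sigma; field.
rewrite q1E q2E siE /line_energy /perspective /kinetic2 mul0r !addr0.
have -> : 1 - (w_al w + b * t) = 1 - w_al w + - b * t by ring.

rewrite !addrA; congr (_ + _ + _ + _). field.
by rewrite rho0 at0 !lt0r_neq0.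
Qed.

End lines.

Lemma is_derive_line (R : realType) (V : normedModType R) (f : V -> R)
    (x v : V) (t : R) :
  differentiable f (x + t *: v) ->
  is_derive t (1 : R) (fun t => f (x + t *: v)) ('D_v f (x + t *: v)).
Proof.
move=> df.
have dl : is_diff t (fun t : R => x + t *: v) (fun t : R => t *: v).
  have := @is_diffD R R V (cst x) ( *:%R^~ v) 0 ( *:%R^~ v) t _ _.
  by move=> /(_ _ _); rewrite add0r; apply.
have ldiff : differentiable (fun t : R => x + t *: v) t by exact: ex_diff.
have vE : 'D_1 (fun t : R => x + t *: v) t = v.
  by rewrite deriveE// diff_val scale1r.
split.
  apply/diff_derivable.
  exact: (@differentiable_comp _ _ _ _ (fun t : R => x + t *: v) f t ldiff df).
by rewrite (@derive_comp _ _ _ _ (fun t : R => x + t *: v) f t 1 ldiff df) vE.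
Qed.

Lemma near_line (R : realType) (V : normedModType R) (U : set V) (x v : V) :
  open U -> U x -> \forall t \near (0 : R), U (x + t *: v).
Proof.
move=> oU Ux.
have c : {for (0 : R), continuous (fun t : R => x + t *: v)}.
  by apply: cvgD; [exact: cvg_cst|exact: scalel_continuous].
have := c U; rewrite scale0r addr0; apply.
exact: open_nbhs_nbhs.
Qed.

(** * Second derivative of the energy along the lines *)

Section second_derivative.
Variables (R : realType) (X : two_phase_model R).
Implicit Types (w v : state R).

Hypotheses (hm : 0 < inertia_m X) (hnu : 0 < inertia_nu X).
Hypothesis he1 : class_C 2 [set p : R * R | 0 < p.1] (e1 X).
Hypothesis he2 : class_C 2 [set p : R * R | 0 < p.1] (e2 X).
Hypothesis hei : class_C 2 [set: R] (ei X).

Let ei2 (p : R * R) := ei X p.2.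

Lemma ei2_C2 : class_C 2 [set p : R * R | 0 < p.1] ei2.
Proof.
have oU : open [set p : R * R | 0 < p.1].
  apply: (@open_comp _ _ (@fst R R) [set x | 0 < x]); last exact: open_gt.
  by move=> p _; exact: cvg_fst.
have csnd : class_C 2 [set p : R * R | 0 < p.1] (@snd R R).
  by apply: (@class_C_linear _ _ _ oU 2 (@snd R R)) => p; exact: cvg_snd.
exact: (@class_C_comp _ _ _ oU 2 [set: R] (ei X) (@snd R R) (fun _ _ => I) hei csnd).
Qed.

(** The perspective terms come from [is_derive_perspective']; the whole has the shape of [Q] in
    [second_variation_gt0]. The energy |K|^2 / (2 rho) is absent, being affine along the lines. *)
Definition energy_hessian w (a b c d : R) : R :=
  let A1 := w_y w * w_rho w in let A2 := (1 - w_y w) * w_rho w in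
  let t1 := w_al w / A1 in let t2 := (1 - w_al w) / A2 in
  let D1 := 'D_((1, 0) : R * R) (e1 X) in let D2 := 'D_((0, 1) : R * R) (e1 X) in
  kinetic2 X w * a ^+ 2
  + ((b - t1 * (A1 * a)) ^+ 2 / A1 * 'D_((1, 0) : R * R) D1 (t1, w_s1 w)
     + 2 * (A1 * a) * c * D2 (t1, w_s1 w)
     + (b - t1 * (A1 * a)) * c *
       ('D_((1, 0) : R * R) D2 (t1, w_s1 w) + 'D_((0, 1) : R * R) D1 (t1, w_s1 w))
     + A1 * c ^+ 2 * 'D_((0, 1) : R * R) D2 (t1, w_s1 w))
  + (- b - t2 * (A2 * a)) ^+ 2 / A2 *
    'D_((1, 0) : R * R) ('D_((1, 0) : R * R) (e2 X)) (t2, w_s2 w)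
  + w_a w * (w_rho w * (a * sigma w + d) / w_a w) ^+ 2 *
    'D_((0, 1) : R * R) ('D_((0, 1) : R * R) ei2)
       (1 / w_a w, w_rho w * sigma w / w_a w).

Lemma near_derive_energy_dir w a b c d : admissible w ->
  \forall t \near (0 : R),
    is_derive t (1 : R) (fun t => total_energy X (w + t *: dir w a b c d))
      ('D_(dir w a b c d) (total_energy X) (w + t *: dir w a b c d)).
Proof.
move=> wA; have oA := @open_admissible R.
have [dE _] := total_energy_C2 hm hnu he1 he2 hei.
apply: filterS (near_line (dir w a b c d) oA wA) => t tA.
exact: (is_derive_line (dE _ tA)).
Qed.

Lemma is_derive_energy_dir w a b c d : admissible w -> a * d = 0 ->
  is_derive (0 : R) (1 : R)
    (fun t => 'D_(dir w a b c d) (total_energy X) (w + t *: dir w a b c d))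
    (energy_hessian w a b c d).
Proof.
move=> wA ad0; have oA := @open_admissible R.
set v := dir w a b c d.
pose F1' := perspective' (e1 X) (w_y w * w_rho w) (w_y w * w_rho w * a) (w_al w) b
  (w_s1 w) c.
pose F2' := perspective' (e2 X) ((1 - w_y w) * w_rho w)
  ((1 - w_y w) * w_rho w * a) (1 - w_al w) (- b) (w_s2 w) 0.
pose F3' := perspective' ei2 (w_a w) 0 1 0 (w_rho w * sigma w / w_a w)
  (w_rho w * (a * sigma w + d) / w_a w).
pose k := 2^-1 * (w_rho w)^-1 * dot3 (w_K w) (w_K w).
pose l := kinetic2 X w * a.
pose G t := a * k + (l + l * a * t) + F1' t + F2' t + F3' t.
have [rho0 /andP[y0 y1] /andP[al0 al1] a0] := wA.
have y1' : 0 < 1 - w_y w by rewrite subr_gt0.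
have al1' : 0 < 1 - w_al w by rewrite subr_gt0.
have GE : \forall t \near (0 : R), G t = 'D_v (total_energy X) (w + t *: v).
  have dL t : admissible (w + t *: v) ->
      is_derive t (1 : R) (line_energy X w a b c d) (G t).
    move=> [] ; rewrite /v dir_rho dir_y dir_al dir_a => r' _ /andP[p1 p2] _.
    have at0 : 0 < 1 + a * t by move: r'; rewrite pmulr_lgt0.
    have d1 : is_derive t (1 : R) (perspective (e1 X) (w_y w * w_rho w)
        (w_y w * w_rho w * a) (w_al w) b (w_s1 w) c) (F1' t).
      apply: (is_derive_perspective _ _ he1) => //.
      rewrite [ltRHS](_ : _ = w_y w * w_rho w * (1 + a * t)); last by ring.
      by rewrite !mulr_gt0.
    have d2 : is_derive t (1 : R) (perspective (e2 X) ((1 - w_y w) * w_rho w)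
        ((1 - w_y w) * w_rho w * a) (1 - w_al w) (- b) (w_s2 w) 0) (F2' t).
      apply: (is_derive_perspective _ _ he2) => //.
        rewrite [ltRHS](_ : _ = (1 - w_y w) * w_rho w * (1 + a * t)); last by ring.
        by rewrite !mulr_gt0.
      by rewrite mulNr -addrA -opprD subr_gt0.
    have d3 : is_derive t (1 : R) (perspective ei2 (w_a w) 0 1 0
        (w_rho w * sigma w / w_a w) (w_rho w * (a * sigma w + d) / w_a w)) (F3' t).
      by apply: (is_derive_perspective _ _ ei2_C2); rewrite mul0r addr0.
    have da := is_derive_affine 1 a t.
    have d0 := is_deriveM1 da (is_derive_cst k t (1 : R)).
    have dq := is_deriveM1 (is_deriveM1 da da)
      (is_derive_cst (kinetic2 X w / 2) t (1 : R)).
    apply: is_derive_eq (is_deriveD1 (is_deriveD1 (is_deriveD1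
      (is_deriveD1 d0 dq) d1) d2) d3) _.
    rewrite /G; congr (_ + _ + _ + _).
    by rewrite /= /l; field.
  (* Derivatives at t can be compared only if the energy and [line_energy] agree on a whole
     neighbourhood of t, hence the nested neighbourhoods. *)
  have : \forall t \near (0 : R), \forall t' \near t, admissible (w + t' *: v).
    exact/near_join/near_line.
  apply: filterS => t tA; have tA0 := nbhs_singleton tA.
  have [dE _] := total_energy_C2 hm hnu he1 he2 hei.
  have [_ <-] := is_derive_line (dE _ tA0).
  have := dL _ tA0.
  have e : \forall t' \near t,
      line_energy X w a b c d t' = total_energy X (w + t' *: v).
    apply: filterS tA => t' tA'; rewrite total_energy_dir//.
    have [] := tA'; rewrite /v dir_rho => r' _ _ _.
    by apply/lt0r_neq0; move: r'; rewrite pmulr_lgt0.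
  by move/(near_eq_is_derive e) => [_ <-].
apply: near_eq_is_derive GE _.
have d1 := @is_derive_perspective' _ (e1 X) (w_y w * w_rho w)
  (w_y w * w_rho w * a) (w_al w) b (w_s1 w) c he1 (mulr_gt0 y0 rho0) al0.
have d2 := @is_derive_perspective' _ (e2 X) ((1 - w_y w) * w_rho w)
  ((1 - w_y w) * w_rho w * a) (1 - w_al w) (- b) (w_s2 w) 0 he2
  (mulr_gt0 y1' rho0) al1'.
have d3 := @is_derive_perspective' _ ei2 (w_a w) 0 1 0 (w_rho w * sigma w / w_a w)
  (w_rho w * (a * sigma w + d) / w_a w) ei2_C2 a0 ltr01.
have d0 := is_deriveD1 (is_derive_cst (a * k) (0 : R) (1 : R))
  (is_derive_affine l (l * a) 0).
apply: is_derive_eq (is_deriveD1 (is_deriveD1 (is_deriveD1 d0 d1) d2) d3) _.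
rewrite /energy_hessian /= /l.
congr (_ + _ + _ + _).
- by ring.
- by rewrite expr0n /= !(mulr0, mul0r, addr0).
- by rewrite mulr0 subr0 expr0n /= !(mulr0, mul0r, add0r).
Qed.

End second_derivative.

(** * Convexity and strict positivity along [stretch] *)

Lemma convex_function_midpoint (R : realType) (V : lmodType R) (D : set V)
    (f : V -> R) (x y : V) :
  convex_function D f -> D x -> D y ->
  f (2^-1 *: (x + y)) + f (2^-1 *: (x + y)) <= f x + f y.
Proof.
move=> cf Dx Dy.
have h01 : (0 <= (2^-1 : R) <= 1) by rewrite invr_ge0 ler0n invf_le1 ?ler1n.
have /(_ x y) := cf (Itv01 (proj1 (andP h01)) (proj2 (andP h01))).
rewrite !inE => /(_ Dx Dy).
rewrite convRE /conv /= /unstable.onem.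
have -> : 1 - (2^-1 : R) = 2^-1 by field.
by rewrite -scalerDr; lra.
Qed.

Section strict.
Variables (R : realType) (X : two_phase_model R).
Hypotheses (hm : 0 < inertia_m X) (hnu : 0 < inertia_nu X).
Hypothesis he1 : class_C 2 [set p : R * R | 0 < p.1] (e1 X).
Hypothesis he2 : class_C 2 [set p : R * R | 0 < p.1] (e2 X).
Hypothesis hei : class_C 2 [set: R] (ei X).
Hypothesis hT1 : forall tau s : R, 0 < tau -> 0 < temperature (e1 X) tau s.

Variables (Om : set (state R)) (w : state R).
Hypotheses (oOm : open Om) (OmA : Om `<=` @admissible R)
  (cE : convex_function Om (total_energy X)) (Omw : Om w).

Lemma energy_hessian_ge0 a b c d : a * d = 0 -> 0 <= energy_hessian X w a b c d.
Proof.
move=> ad0; set v := dir w a b c d.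
have wA := OmA Omw.
apply: (convex_derive2_ge0 (near_derive_energy_dir hm hnu he1 he2 hei a b c d wA)
  (is_derive_energy_dir hm hnu he1 he2 hei b c wA ad0)).
apply: filterS2 (near_line v oOm Omw) (near_line (- v) oOm Omw) => t tp tm.
have := convex_function_midpoint cE tp tm.
have -> : 2^-1 *: (w + t *: v + (w + t *: - v)) = w.
  by rewrite scalerN addrACA subrr addr0 -mulr2n -(scaler_nat 2 w)
    scalerA mulVf ?scale1r//.
by rewrite !scale0r !addr0 scalerN -scaleNr.
Qed.

Lemma energy_hessian_stretch_gt0 : 0 < energy_hessian X w 1 0 0 0.
Proof.
have [rho0 /andP[y0 y1] /andP[al0 al1] a0] := OmA Omw.
have y1' : 0 < 1 - w_y w by rewrite subr_gt0.
have al1' : 0 < 1 - w_al w by rewrite subr_gt0.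
apply: second_variation_gt0 energy_hessian_ge0 => //;
  rewrite ?mulr_gt0 ?divr_gt0 ?mulr_gt0//.
- by apply: addr_ge0; apply: divr_ge0; (exact: ltW || rewrite -expr2 sqr_ge0).
- by rewrite invr_gt0 mulr_gt0.
- by rewrite invr_gt0 mulr_gt0.
- by apply: hT1; rewrite divr_gt0 ?mulr_gt0.
Qed.

End strict.

(** * Gradients of the energy and of the pressure *)

Lemma derive_line (R : realType) (V : normedModType R) (f : V -> R)
    (x v : V) (l : R) :
  differentiable f x -> is_derive (0 : R) (1 : R) (fun t => f (x + t *: v)) l ->
  'D_v f x = l.
Proof.
move=> df [_ <-]; have x0 : x + (0 : R) *: v = x by rewrite scale0r addr0.
have [|_ ->] := @is_derive_line R V f x v 0; first by rewrite x0.
by rewrite x0.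
Qed.

(** The energy is exactly quadratic in each of K_j, M and P; its partial derivatives there are read
    off as linear coefficients. *)
Lemma derive_quadratic_line (R : realType) (V : normedModType R) (f : V -> R)
    (x v : V) (l c : R) :
  differentiable f x -> (forall t, f (x + t *: v) = f x + l * t + c * (t * t)) ->
  'D_v f x = l.
Proof.
move=> df fE; apply: derive_line => //.
have -> : (fun t => f (x + t *: v)) = (fun t => f x + l * t + c * (t * t)).
  exact/funext.
have d0 : is_derive (0 : R) (1 : R) (@id R) 1 by exact: is_derive_id.
apply: is_derive_eq (is_deriveD1 (is_derive_affine (f x) l 0)
  (is_deriveM1 (is_derive_cst c (0 : R) (1 : R)) (is_deriveM1 d0 d0))) _.
by rewrite /= !(mul0r, mulr0, mulr1, addr0).
Qed.

Section gradient.
Variables (R : realType) (X : two_phase_model R).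
Implicit Types (w v : state R).
Hypotheses (hm : 0 < inertia_m X) (hnu : 0 < inertia_nu X).
Hypothesis he1 : class_C 2 [set p : R * R | 0 < p.1] (e1 X).
Hypothesis he2 : class_C 2 [set p : R * R | 0 < p.1] (e2 X).
Hypothesis hei : class_C 2 [set: R] (ei X).

Let E := total_energy X.
Let eM := base R (@Ordinal 12 4 isT).
Let eP := base R (@Ordinal 12 5 isT).
Let eal := base R (@Ordinal 12 6 isT).
Let ea := base R (@Ordinal 12 7 isT).

Lemma differentiable_energy w : admissible w -> differentiable E w.
Proof.
by move=> wA; have [dE _] := total_energy_C2 hm hnu he1 he2 hei; exact: dE.
Qed.

Lemma w_K_eq w w' : (forall j, w' (iK j) 0 = w (iK j) 0) -> w_K w' = w_K w.
Proof. by move=> h; apply/rowP => j; rewrite !w_KE h. Qed.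

Lemma dot3_uK w : w_rho w != 0 ->
  dot3 (w_u w) (w_K w) = w_rho w * dot3 (w_u w) (w_u w).
Proof.
move=> rho0; rewrite /dot3 mulr_sumr; apply: eq_bigr => j _.
by rewrite !mxE; field.
Qed.

Lemma L_atE w : w_rho w != 0 ->
  L_at X w = w_rho w * dot3 (w_u w) (w_u w) + kinetic2 X w - E w.
Proof.
move=> rho0; rewrite /E /total_energy opprB dot3_uK// /w_dal /w_da !mulrA.
by rewrite /kinetic2; ring.
Qed.

Let lag w (x : R) := lagrangian X x (w_s w) (w_s1 w) (w_s2 w) (w_a w) (w_y w)
  (w_al w) (w_u w) (w_dal X w) (w_da X w).

Lemma stretchE w : stretch w = dir w 1 0 0 0.
Proof. by rewrite /dir mul0r !scale0r !addr0 scale0r addr0 scale1r. Qed.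

(** Changing rho alone in L keeps D_t alpha and D_t a_i, while moving along [stretch] keeps u but
    scales M and P, hence these rates too. The two quadratic energies therefore add up to
    [kinetic2 X w / 2] with weights 1 and (1 + t)^2, and the internal energies cancel. *)
Lemma lagrangian_dir w t : w_rho w != 0 -> 1 + t != 0 ->
  lag w ((1 + t) * w_rho w) = (1 + t) * w_rho w * dot3 (w_u w) (w_u w)
    + (1 + (1 + t) ^+ 2) * (kinetic2 X w / 2) - E (w + t *: stretch w).
Proof.
move=> rho0 t0; have t1 : (1 + t) = 1 + 1 * t by rewrite mul1r.
rewrite /E /total_energy /L_at stretchE.
have -> : w_u (w + t *: dir w 1 0 0 0) = w_u w.
  rewrite /w_u dir_rho dir_K scalerA -t1; congr (_ *: _).
  by field; rewrite t0 rho0.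
rewrite /w_dal /w_da dir_rho dir_K dir_M dir_P dir_al dir_a dir_s dir_s1 dir_s2 dir_y.
rewrite -t1 !mul0r !addr0 mul0r addr0.
have -> : dot3 (w_u w) ((1 + t) *: w_K w) =
    (1 + t) * (w_rho w * dot3 (w_u w) (w_u w)).
  rewrite -dot3_uK// /dot3 mulr_sumr; apply: eq_bigr => j _.
  by rewrite [((1 + t) *: w_K w) 0 j]mxE mulrCA.
rewrite /lag /lagrangian /kinetic2 /w_dal /w_da.
move: (mixture_energy _ _ _ _ _ _ _ _) (dot3 _ _) => e k.
by field; rewrite !lt0r_neq0.
Qed.

Lemma is_derive_lagrangian_rho w : admissible w ->
  is_derive (w_rho w) (1 : R) (lag w)
    (dot3 (w_u w) (w_u w) + (kinetic2 X w - 'D_(stretch w) E w) / w_rho w).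
Proof.
move=> wA; have [r0 _ _ _] := wA; have rho0 := lt0r_neq0 r0.
set rho := w_rho w in r0 rho0 *; set k := dot3 _ _; set B := kinetic2 X w.
(* With this scaling, [w - stretch w + x *: v] is w + (x / rho - 1) r, the point of the line whose
   density is x. *)
pose v := rho^-1 *: stretch w.
pose G (x : R) := (k * x + (x * x) * (B / rho ^+ 2 / 2)) + B / 2
  - E (w - stretch w + x *: v).
have GE : \forall x \near rho, G x = lag w x.
  have : \forall x \near rho, x != 0.
    by apply: filterS (lt_nbhsr r0) => x /lt0r_neq0.
  apply: filterS => x x0.
  have xE : x = (1 + (x / rho - 1)) * rho by field.
  rewrite [in RHS]xE lagrangian_dir//; last by rewrite subrKC mulf_neq0 ?invr_neq0.
  rewrite /G -/k -/B; congr (_ - E _); last first.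
    by rewrite /v scalerA scalerBl scale1r -addrA [_ - stretch w]addrC.
  by rewrite -/rho; field.
have wE : w - stretch w + rho *: v = w.
  by rewrite /v scalerA divff// scale1r subrK.
apply: near_eq_is_derive GE _.
have dl : is_derive rho (1 : R) (fun x => E (w - stretch w + x *: v))
    ('D_v E (w - stretch w + rho *: v)).
  by apply: is_derive_line; rewrite wE; exact: differentiable_energy.
have d0 : is_derive rho (1 : R) (@id R) 1 by exact: is_derive_id.
have dk := is_deriveM1 (is_derive_cst k rho (1 : R)) d0.
have dB := is_deriveM1 (is_deriveM1 d0 d0) (is_derive_cst (B / rho ^+ 2 / 2) rho (1 : R)).
have dp := is_deriveD1 (is_deriveD1 dk dB) (is_derive_cst (B / 2) rho (1 : R)).
apply: is_derive_eq (is_deriveB dp dl) _.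
rewrite wE /v deriveZdir; last exact: differentiable_energy.
by rewrite /GRing.scale /=; field.
Qed.

(** Both rho dL/drho and L contain rho |u|^2 + [kinetic2 X w], minus ['D_(stretch w) E w] and [E w]
    respectively; the common part cancels. *)
Lemma LstarE w : admissible w -> Lstar X w = E w - 'D_(stretch w) E w.
Proof.
move=> wA; have [r0 _ _ _] := wA; have rho0 := lt0r_neq0 r0.
rewrite /Lstar L_atE// /dL_drho derive1E.
have [_ ->] := is_derive_lagrangian_rho wA.
by field.
Qed.

(** K enters L only through rho |u|^2 / 2, which is linear in rho at fixed u. Changing K thus adds
    [c * x] to L, and such a term drops out of rho dL/drho - L. *)
Lemma Lstar_K w w' : admissible w ->
  (forall i : 'I_12, ~~ (0 < i < 4)%N -> w' i 0 = w i 0) ->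
  Lstar X w' = Lstar X w.
Proof.
move=> wA h; have [r0 _ _ _] := wA.
have hrho : w_rho w' = w_rho w := h (@Ordinal 12 0 isT) isT.
pose c := 2^-1 * (dot3 (w_u w') (w_u w') - dot3 (w_u w) (w_u w)).
have lagE x : lag w' x = lag w x + c * x.
  rewrite /lag /lagrangian /w_dal /w_da /w_M /w_P /w_s /w_s1 /w_s2 /w_a /w_y /w_al.
  by rewrite !h// /c; ring.
rewrite /Lstar hrho /dL_drho hrho derive1E derive1E.
have [dl dlE] := is_derive_lagrangian_rho wA.
have dl' := is_deriveD1 (is_derive_lagrangian_rho wA)
  (is_derive_affine 0 c (w_rho w)).
have -> : L_at X w' = L_at X w + c * w_rho w by rewrite -lagE /lag -hrho.
have [_ +] := dl'.
have -> : (fun t => lag w t + (0 + c * t)) = lag w'.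
  by apply/funext => x; rewrite lagE add0r.
by move=> ->; rewrite dlE; ring.
Qed.

Lemma derive_Lstar_K w j : admissible w -> 'D_(base R (iK j)) (Lstar X) w = 0.
Proof.
move=> wA; rewrite /derive.
have -> : (fun h : R => h^-1 *: ((Lstar X \o shift w) (h *: base R (iK j)) - Lstar X w))
    = cst 0.
  apply/funext => h /=; rewrite (@Lstar_K w) ?subrr ?scaler0// => i ij.
  rewrite !mxE [i == _](_ : _ = false) ?mulr0 ?add0r//.
  by apply: contraNF ij => /eqP ->; rewrite /= add1n ltnS ltn_ord.
exact: lim_cst.
Qed.

Lemma derive_energy_K w j : admissible w -> 'D_(base R (iK j)) E w = w_u w 0 j.
Proof.
move=> wA; have [r0 _ _ _] := wA; have rho0 := lt0r_neq0 r0.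
apply: (@derive_quadratic_line _ _ _ _ _ _ (2^-1 * (w_rho w)^-1)).
  exact: differentiable_energy.
move=> t; set w' := w + _.
have h (i : 'I_12) : ~~ (0 < i < 4)%N -> w' i 0 = w i 0.
  move=> ij; rewrite !mxE [i == _](_ : _ = false) ?mulr0 ?addr0//.
  by apply: contraNF ij => /eqP ->; rewrite /= add1n ltnS ltn_ord.
have hrho : w_rho w' = w_rho w := h (@Ordinal 12 0 isT) isT.
rewrite /E !total_energyE ?hrho// /w_M /w_P /w_s /w_s1 /w_s2 /w_a /w_y /w_al !h//.
have -> : dot3 (w_K w') (w_K w') =
    dot3 (w_K w) (w_K w) + 2 * t * w_K w 0 j + t * t.
  rewrite /dot3 (bigD1 j)//= [in RHS](bigD1 j)//= !w_KE.
  have -> : w' (iK j) 0 = w (iK j) 0 + t by rewrite !mxE !eqxx mulr1.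
  rewrite (eq_bigr (fun i => w_K w 0 i * w_K w 0 i)); last first.
    move=> i ij; rewrite !w_KE !mxE (inj_eq iK_inj) (negbTE ij).
    by rewrite mulr0 addr0.
  by ring.
rewrite w_uE w_KE; move: (w (iK j) 0) => Kj; field.
by rewrite rho0 !lt0r_neq0.
Qed.

Lemma derive_energy_M w : admissible w -> 'D_eM E w = w_dal X w.
Proof.
move=> wA; have [r0 _ _ _] := wA; have rho0 := lt0r_neq0 r0.
apply: (@derive_quadratic_line _ _ _ _ _ _ (2 * inertia_m X)^-1).
  exact: differentiable_energy.
move=> t; set w' := w + _.
have h (i : 'I_12) : val i != 4%N -> w' i 0 = w i 0.
  by move=> ij; rewrite !mxE -val_eqE /= (negbTE ij) mulr0 addr0.
have hM : w_M w' = w_M w + t by rewrite /w_M !mxE eqxx mulr1.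
have hrho : w_rho w' = w_rho w := h (@Ordinal 12 0 isT) isT.
have hK : w_K w' = w_K w by apply: w_K_eq => -[[|[|[|?]]] ?]//; rewrite h.
rewrite /E !total_energyE ?hrho// hK hM /w_P /w_s /w_s1 /w_s2 /w_a /w_y /w_al !h//.
by rewrite /w_dal; field; rewrite rho0 !lt0r_neq0.
Qed.

Lemma derive_energy_P w : admissible w -> 'D_eP E w = w_da X w.
Proof.
move=> wA; have [r0 _ _ _] := wA; have rho0 := lt0r_neq0 r0.
apply: (@derive_quadratic_line _ _ _ _ _ _ (2 * inertia_nu X)^-1).
  exact: differentiable_energy.
move=> t; set w' := w + _.
have h (i : 'I_12) : val i != 5%N -> w' i 0 = w i 0.
  by move=> ij; rewrite !mxE -val_eqE /= (negbTE ij) mulr0 addr0.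
have hP : w_P w' = w_P w + t by rewrite /w_P !mxE eqxx mulr1.
have hrho : w_rho w' = w_rho w := h (@Ordinal 12 0 isT) isT.
have hK : w_K w' = w_K w by apply: w_K_eq => -[[|[|[|?]]] ?]//; rewrite h.
rewrite /E !total_energyE ?hrho// hK hP /w_M /w_s /w_s1 /w_s2 /w_a /w_y /w_al !h//.
by rewrite /w_da; field; rewrite rho0 !lt0r_neq0.
Qed.

(* The velocities do not depend on the i-th coordinate, so the Legendre
   transform only changes the sign of the derivative. *)
Let derive_energy_L w (i : 'I_12) (l : R -> R) (c : R) : admissible w ->
  (forall x : R, E (w - w i 0 *: base R i + x *: base R i) = c - l x) ->
  'D_(base R i) E w = - derive1 l (w i 0).
Proof.
move=> wA lE; set v := base R i; set w0 := w - w i 0 *: v.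
have wE : w0 + w i 0 *: v = w by rewrite subrK.
have [|dl dE] := @is_derive_line _ _ E w0 v (w i 0).
  by rewrite wE; exact: differentiable_energy.
rewrite wE in dE.
have -> : l = (fun x => c - E (w0 + x *: v)).
  by apply/funext => x; rewrite lE subKr.
rewrite derive1E.
have [_ ->] := is_deriveB (is_derive_cst c (w i 0) (1 : R)) (DeriveDef dl dE).
by rewrite sub0r opprK.
Qed.

Lemma derive_energy_al w : admissible w -> 'D_eal E w = - dL_dal X w.
Proof.
move=> wA; apply: (@derive_energy_L w (@Ordinal 12 6 isT) _
  (dot3 (w_u w) (w_K w) + w_M w * w_dal X w + w_P w * w_da X w)) => // x.
set w' := _ + _ *: _.
have h (i : 'I_12) : val i != 6%N -> w' i 0 = w i 0.
  by move=> ij; rewrite !mxE -val_eqE /= (negbTE ij) !mulr0 subr0 addr0.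
have hx : w_al w' = x by rewrite /w_al !mxE eqxx !mulr1 subrr add0r.
have hK : w_K w' = w_K w by apply: w_K_eq => -[[|[|[|?]]] ?]//; rewrite h.
rewrite /E /total_energy /L_at hx /w_u hK.
by rewrite /w_dal /w_da /w_rho /w_M /w_P /w_s /w_s1 /w_s2 /w_a /w_y !h.
Qed.

Lemma derive_energy_a w : admissible w -> 'D_ea E w = - dL_da X w.
Proof.
move=> wA; apply: (@derive_energy_L w (@Ordinal 12 7 isT) _
  (dot3 (w_u w) (w_K w) + w_M w * w_dal X w + w_P w * w_da X w)) => // x.
set w' := _ + _ *: _.
have h (i : 'I_12) : val i != 7%N -> w' i 0 = w i 0.
  by move=> ij; rewrite !mxE -val_eqE /= (negbTE ij) !mulr0 subr0 addr0.
have hx : w_a w' = x by rewrite /w_a !mxE eqxx !mulr1 subrr add0r.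
have hK : w_K w' = w_K w by apply: w_K_eq => -[[|[|[|?]]] ?]//; rewrite h.
rewrite /E /total_energy /L_at hx /w_u hK.
by rewrite /w_dal /w_da /w_rho /w_M /w_P /w_s /w_s1 /w_s2 /w_al /w_y !h.
Qed.

Definition source w : state R :=
  dL_dal X w *: eM + dL_da X w *: eP + w_dal X w *: eal + w_da X w *: ea.

(** The source is Hamiltonian in the conjugate pairs (alpha, M) and (a_i, P): dE/dM = D_t alpha and
    dE/d alpha = - dL/d alpha, so the two contributions of each pair cancel. *)
Lemma derive_energy_source w : admissible w -> 'D_(source w) E w = 0.
Proof.
move=> wA; have dE := differentiable_energy wA.
rewrite /source !(deriveDdir _ _ dE) !(deriveZdir _ _ dE).
rewrite derive_energy_M// derive_energy_P// derive_energy_al// derive_energy_a//.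
by rewrite /GRing.scale /=; ring.
Qed.

End gradient.

(** * Continuity of matrix-valued maps *)

Section mx_continuity.
Variables (R : realType) (T : topologicalType) (t : T).

Lemma continuous_mxP m n (M : T -> 'M[R]_(m, n)) :
  (forall i j, {for t, continuous (fun t => M t i j)}) -> {for t, continuous M}.
Proof.
move=> cM A [P nP PA]; rewrite nbhs_simpl /=.
have : \forall t' \near t, forall i j, P i j (M t' i j).
  apply: filter_forall => i; apply: filter_forall => j.
  exact: cM (nP i j).
by apply: filterS => t' Pt'; apply: PA.
Qed.

Lemma continuous_mx_coord m n (M : T -> 'M[R]_(m, n)) i j :
  {for t, continuous M} -> {for t, continuous (fun t => M t i j)}.
Proof.
move=> cM; apply: (@continuous_comp _ _ _ M (fun N => N i j) t cM).
exact: coord_continuous.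
Qed.

Lemma continuous_sum_at (n : nat) (F : 'I_n -> T -> R) :
  (forall i, {for t, continuous (F i)}) ->
  {for t, continuous (fun t => \sum_i F i t)}.
Proof.
elim: n F => [|n ih] F cF.
  rewrite (_ : (fun _ => _) = cst 0); first exact: cvg_cst.
  by apply/funext => t'; rewrite big_ord0.
rewrite (_ : (fun _ => _) = (fun t => F ord0 t + \sum_i F (lift ord0 i) t)).
  exact: cvgD (cF _) (ih _ (fun i => cF _)).
by apply/funext => t'; rewrite big_ord_recl.
Qed.

Lemma continuous_mulmx m n p (M : T -> 'M[R]_(m, n)) (N : T -> 'M[R]_(n, p)) :
  {for t, continuous M} -> {for t, continuous N} ->
  {for t, continuous (fun t => M t *m N t)}.
Proof.
move=> cM cN; apply: continuous_mxP => i j.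
rewrite (_ : (fun _ => _) = (fun t => \sum_k M t i k * N t k j)); last first.
  by apply/funext => t'; rewrite mxE.
apply: continuous_sum_at => k.
by apply: cvgM; [exact: continuous_mx_coord cM|exact: continuous_mx_coord cN].
Qed.

Lemma continuous_trmx m n (M : T -> 'M[R]_(m, n)) :
  {for t, continuous M} -> {for t, continuous (fun t => (M t)^T)}.
Proof.
move=> cM; apply: continuous_mxP => i j.
rewrite (_ : (fun _ => _) = (fun t => M t j i)); first exact: continuous_mx_coord.
by apply/funext => t'; rewrite mxE.
Qed.

Lemma continuous_scalemx m n (c : T -> R) (M : T -> 'M[R]_(m, n)) :
  {for t, continuous c} -> {for t, continuous M} ->
  {for t, continuous (fun t => c t *: M t)}.
Proof.
move=> cc cM; apply: continuous_mxP => i j.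
rewrite (_ : (fun _ => _) = (fun t => c t * M t i j)).
  by apply: cvgM; [exact: cc|exact: continuous_mx_coord].
by apply/funext => t'; rewrite mxE.
Qed.

Lemma continuous_addmx m n (M N : T -> 'M[R]_(m, n)) :
  {for t, continuous M} -> {for t, continuous N} ->
  {for t, continuous (fun t => M t + N t)}.
Proof.
move=> cM cN; apply: continuous_mxP => i j.
rewrite (_ : (fun _ => _) = (fun t => M t i j + N t i j)).
  by apply: cvgD; exact: continuous_mx_coord.
by apply/funext => t'; rewrite mxE.
Qed.

Lemma continuous_oppmx m n (M : T -> 'M[R]_(m, n)) :
  {for t, continuous M} -> {for t, continuous (fun t => - M t)}.
Proof.
move=> cM; apply: continuous_mxP => i j.
rewrite (_ : (fun _ => _) = (fun t => - M t i j)).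
  by apply: cvgN; exact: continuous_mx_coord.
by apply/funext => t'; rewrite mxE.
Qed.

Lemma continuous_summx m n p (F : 'I_p -> T -> 'M[R]_(m, n)) :
  (forall k, {for t, continuous (F k)}) ->
  {for t, continuous (fun t => \sum_k F k t)}.
Proof.
move=> cF; apply: continuous_mxP => i j.
rewrite (_ : (fun _ => _) = (fun t => \sum_k F k t i j)).
  by apply: continuous_sum_at => k; exact: continuous_mx_coord.
by apply/funext => t'; rewrite summxE.
Qed.

Lemma continuous_dotc n (u v : T -> 'cV[R]_n.+1) :
  {for t, continuous u} -> {for t, continuous v} ->
  {for t, continuous (fun t => dotc (u t) (v t))}.
Proof.
move=> cu cv; apply: continuous_mx_coord.
exact: continuous_mulmx (continuous_trmx cu) cv.
Qed.

(** The vectors [x] do not depend on the point, so [proj_orth x] is constant; the two nonvanishing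
    conditions are for the two inverses in the construction. *)
Lemma continuous_symmetrizer n p (rho : T -> R) (r g : T -> 'cV[R]_n.+1)
    (x : 'I_p -> 'cV[R]_n.+1) (d : 'I_p -> T -> 'cV[R]_n.+1) :
  {for t, continuous rho} -> {for t, continuous r} -> {for t, continuous g} ->
  (forall j, {for t, continuous (d j)}) ->
  dotc (g t) (r t) != 0 ->
  dotc (proj_orth x *m r t) (proj_orth x *m r t) != 0 ->
  {for t, continuous (fun t => symmetrizer (rho t) (r t) (g t) x (d ^~ t))}.
Proof.
move=> crho cr cg cd gr0 Dr0.
have cDr : {for t, continuous (fun t => proj_orth x *m r t)}.
  by apply: continuous_mulmx cr; exact: cvg_cst.
have cP : {for t, continuous (fun t => proj_scal (r t) x)}.
  apply: continuous_addmx; first exact: cvg_cst.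
  apply/continuous_oppmx/continuous_scalemx.
    by apply: cvgV => //; exact: continuous_dotc.
  exact: continuous_mulmx cDr (continuous_trmx cDr).
have cS : {for t, continuous (fun t => \sum_j d j t *m (d j t)^T)}.
  apply: continuous_summx => j.
  exact: continuous_mulmx (cd j) (continuous_trmx (cd j)).
have cgr : {for t, continuous (fun t => (dotc (g t) (r t))^-1)}.
  by apply: cvgV => //; exact: continuous_dotc.
exact: continuous_addmx (continuous_addmx (continuous_scalemx crho cS)
  (continuous_scalemx cgr (continuous_mulmx cg (continuous_trmx cg))))
  (continuous_mulmx (continuous_trmx cP) cP).
Qed.
End mx_continuity.

(** * Coefficients of the quasilinear system *)

Section quasilinear.
Variables (R : realType) (X : two_phase_model R).
Implicit Types (w v : state R).
Hypotheses (hm : 0 < inertia_m X) (hnu : 0 < inertia_nu X).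
Hypothesis he1 : class_C 2 [set p : R * R | 0 < p.1] (e1 X).
Hypothesis he2 : class_C 2 [set p : R * R | 0 < p.1] (e2 X).
Hypothesis hei : class_C 2 [set: R] (ei X).

Let E := total_energy X.

(** In E - D_r E the direction r depends on w, so D_r E is expanded in the basis with coordinates of
    [stretch] as coefficients. One derivative is lost: phasic energies of class C^2 leave exactly
    the continuity of [grad_Pi] required of the symmetrizer. *)
Lemma Lstar_C1 : class_C 1 (@admissible R) (Lstar X).
Proof.
have oA := @open_admissible R.
have cE2 := total_energy_C2 hm hnu he1 he2 hei.
have [dE cDE] := cE2.
have cst i : class_C 1 (@admissible R) (fun w => stretch w i 0).
  have [ile|ige] := boolP (i < 6)%N.
    apply: (class_C_eq oA _ (class_C_state_coord 1 i oA)) => w _.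
    by rewrite mxE ile.
  apply: (class_C_eq oA _ (class_C_cst oA 1 0)) => w _.
  by rewrite mxE (negbTE ige).
have cterm i := class_CM oA (cst i) (cDE (base R i)).
have csum := @class_C_sum _ _ _ oA 1 12 _ cterm.
apply: (class_C_eq oA _ (class_CD oA (class_CS cE2) (class_CN oA csum))) => w.
rewrite inE => wA; rewrite (LstarE hm hnu he1 he2 hei wA) {2}(state_sum (stretch w)).
rewrite derive_sumdir; last exact: dE.
congr (_ - _); apply: eq_bigr => i _.
by rewrite deriveZdir//; exact: dE.
Qed.

Lemma differentiable_Lstar w : admissible w -> differentiable (Lstar X) w.
Proof. by move=> wA; have [dL _] := Lstar_C1; exact: dL. Qed.

Definition grad_Pi w : state R := \col_i - 'D_(base R i) (Lstar X) w.

Lemma grad_PiE w v : admissible w -> dotc (grad_Pi w) v = - 'D_v (Lstar X) w.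
Proof.
move=> wA; have dL := differentiable_Lstar wA.
rewrite {2}(state_sum v) derive_sumdir// dotcE -sumrN; apply: eq_bigr => i _.
by rewrite deriveZdir// mxE mulNr mulrC.
Qed.

Lemma grad_Pi_K w j : admissible w -> dotc (grad_Pi w) (base R (iK j)) = 0.
Proof.
by move=> wA; rewrite grad_PiE// (derive_Lstar_K hm hnu he1 he2 hei)// oppr0.
Qed.

(* Along [w + t stretch w], [- Lstar = (1 + t) phi' - phi] with
   [phi t = E (w + t stretch w)]. *)
Lemma grad_Pi_stretch w : admissible w ->
  dotc (grad_Pi w) (stretch w) = energy_hessian X w 1 0 0 0.
Proof.
move=> wA; have oA := @open_admissible R.
set v := stretch w; set h := energy_hessian _ _ _ _ _ _.
have vE : v = dir w 1 0 0 0 by exact: stretchE.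
have LE : \forall t \near (0 : R),
    E (w + t *: v) - (1 + 1 * t) * 'D_v E (w + t *: v) = Lstar X (w + t *: v).
  apply: filterS (near_line v oA wA) => t tA.
  rewrite (LstarE hm hnu he1 he2 hei tA).
  have -> : stretch (w + t *: v) = (1 + 1 * t) *: v.
    by rewrite {1}vE stretch_dir.
  by rewrite deriveZdir//; exact: differentiable_energy.
have w0 : w + (0 : R) *: v = w by rewrite scale0r addr0.
have dE : is_derive (0 : R) (1 : R) (fun t => E (w + t *: v)) ('D_v E w).
  rewrite -{2}w0; apply: is_derive_line; rewrite w0.
  exact: differentiable_energy.
have dDE : is_derive (0 : R) (1 : R) (fun t => 'D_v E (w + t *: v)) h.
  by rewrite vE; apply: is_derive_energy_dir; rewrite ?mulr0.
have dL : is_derive (0 : R) (1 : R) (fun t => Lstar X (w + t *: v)) (- h).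
  apply: near_eq_is_derive LE _.
  apply: is_derive_eq (is_deriveB dE (is_deriveM1 (is_derive_affine 1 1 0) dDE)) _.
  by rewrite /= w0; ring.
by rewrite grad_PiE// (derive_line (differentiable_Lstar wA) dL) opprK.
Qed.

Lemma grad_Pi_continuous w : admissible w -> {for w, continuous grad_Pi}.
Proof.
move=> wA; apply: continuous_mxP => i j.
rewrite (_ : (fun _ => _) = (fun w => - 'D_(base R i) (Lstar X) w)); last first.
  by apply/funext => w'; rewrite mxE.
by have [_ cL] := Lstar_C1; exact: (cvgN (cL (base R i) w wA)).
Qed.

Definition dvel w (j : 'I_3) : state R :=
  (w_rho w)^-1 *: (base R (iK j) - w_u w 0 j *: base R (@Ordinal 12 0 isT)).

Lemma dotc_base (i : 'I_12) v : dotc (base R i) v = v i 0.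
Proof.
rewrite dotcE (bigD1 i)//= big1 => [|k ki].
  by rewrite !mxE !eqxx mul1r addr0.
by rewrite !mxE (negbTE ki) mul0r.
Qed.

Lemma dotc_dvel w j v :
  dotc (dvel w j) v = (v (iK j) 0 - w_u w 0 j * w_rho v) / w_rho w.
Proof.
rewrite dotcC dotcZr dotcBr dotcZr ![dotc v _]dotcC !dotc_base mulrC.
by [].
Qed.

(** The velocity K / rho is invariant under a common scaling of K and rho. *)
Lemma dvel_stretch w j : admissible w -> dotc (dvel w j) (stretch w) = 0.
Proof.
move=> [/lt0r_neq0 rho0 _ _ _]; rewrite dotc_dvel w_uE /w_rho !mxE /=.
have -> : (1 + j < 6)%N by rewrite add1n ltnS (ltn_trans (ltn_ord j)).
by rewrite -/(w_rho w) divfK// subrr mul0r.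
Qed.

Lemma dvel_K w i j : dotc (dvel w i) (base R (iK j)) = (i == j)%:R / w_rho w.
Proof.
have rho0 : w_rho (base R (iK j)) = 0 by rewrite /w_rho mxE.
by rewrite dotc_dvel rho0 mulr0 subr0 mxE eqxx andbT (inj_eq iK_inj).
Qed.

Lemma w_rho_coord_neq0 w : admissible w -> w_rho w != 0.
Proof. by move=> [/lt0r_neq0]. Qed.

Lemma differentiable_w_u w j : admissible w ->
  differentiable (fun w => w_u w 0 j) w.
Proof.
move=> wA; rewrite (_ : (fun _ => _) = (fun w => w (iK j) 0 * (w_rho w)^-1)).
  apply: differentiableM; first exact: differentiable_coord.
  apply: differentiableV; first exact: differentiable_coord.
  exact: w_rho_coord_neq0.
by apply/funext => w'; rewrite w_uE.
Qed.

Lemma derive_w_u w j v : admissible w ->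
  'D_v (fun w => w_u w 0 j) w = dotc (dvel w j) v.
Proof.
move=> wA; rewrite (_ : (fun _ => _) = (fun w => w (iK j) 0 * (w_rho w)^-1)); last first.
  by apply/funext => w'; rewrite w_uE.
have rho0 := w_rho_coord_neq0 wA.
have drho : derivable (@w_rho R) w v.
  exact/diff_derivable/differentiable_coord.
rewrite (deriveM (f := fun w => w (iK j) 0) (g := fun w => (w_rho w)^-1)); first last.
- exact: derivableV.
- exact/diff_derivable/differentiable_coord.
rewrite deriveV// !derive_coord dotc_dvel w_uE /GRing.scale /= -/(w_rho v).
by move: (w_rho v) => rv; field.
Qed.

Definition sysA (j : 'I_3) w : 'M[R]_12 :=
  (w_u w 0 j)%:M + (stretch w *m (dvel w j)^T + base R (iK j) *m (grad_Pi w)^T).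

Lemma sysA_mul j w v : sysA j w *m v =
  w_u w 0 j *: v + (dotc (dvel w j) v *: stretch w
                    + dotc (grad_Pi w) v *: base R (iK j)).
Proof. by rewrite !mulmxDl mul_scalar_mx !outer_mul. Qed.

Lemma sysA_hyperbolic (Om : set (state R)) : Om `<=` @admissible R ->
  (forall w, Om w -> 0 < dotc (grad_Pi w) (stretch w)) -> hyperbolic Om sysA.
Proof.
move=> OmA pos w Omw xi xi0; have wA := OmA _ Omw.
have [rho0 _ _ _] := wA.
pose d : state R := \sum_j xi 0 j *: dvel w j.
pose x : state R := \sum_j xi 0 j *: base R (iK j).
have -> : \sum_j xi 0 j *: sysA j w = (\sum_j xi 0 j * w_u w 0 j)%:M
    + (stretch w *m d^T + x *m (grad_Pi w)^T).
  rewrite /d /x raddf_sum /= mulmx_suml raddf_sum /= mulmx_sumr -!big_split /=.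
  apply: eq_bigr => j _; rewrite /sysA !scalerDr scale_scalar_mx.
  have -> : (xi 0 j *: dvel w j)^T = xi 0 j *: (dvel w j)^T by rewrite linearZ.
  by rewrite -scalemxAr -scalemxAl.
have dE v : dotc d v = \sum_j xi 0 j * dotc (dvel w j) v.
  by rewrite dotcC dotc_sumr; apply: eq_bigr => j _; rewrite dotcZr dotcC.
apply: diagonalizable_rank2.
- by rewrite dE big1// => j _; rewrite dvel_stretch// mulr0.
- by rewrite dotc_sumr big1// => j _; rewrite dotcZr grad_Pi_K// mulr0.
- apply: mulr_gt0; last exact: pos.
  (* This is |xi|^2 / rho, positive since [xi != 0]. *)
  have -> : dotc d x = (\sum_j xi 0 j ^+ 2) / w_rho w.
    rewrite dE mulr_suml; apply: eq_bigr => j _.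
    rewrite dotc_sumr (bigD1 j)//= big1 => [|i ij].
      by rewrite dotcZr dvel_K eqxx addr0 mul1r mulrA -expr2.
    by rewrite dotcZr dvel_K eq_sym (negbTE ij) mul0r mulr0.
  apply: divr_gt0 => //; rewrite lt_neqAle sumr_ge0 ?andbT => [|j _]; last exact: sqr_ge0.
  apply: contra xi0; rewrite eq_sym psumr_eq0 => [/allP h|j _]; last exact: sqr_ge0.
  apply/eqP/rowP => j; rewrite mxE; apply/eqP.
  by have := h j (mem_index_enum _); rewrite sqrf_eq0.
Qed.

Lemma stretch_continuous w : {for w, continuous (@stretch R)}.
Proof.
apply: continuous_mxP => i j; have [ile|ige] := boolP (i < 6)%N.
  rewrite (_ : (fun _ => _) = (fun w : state R => w i 0)); last first.
    by apply/funext => w'; rewrite mxE ile.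
  exact: coord_continuous.
have -> : (fun w : state R => stretch w i j) = cst 0.
  by apply/funext => w'; rewrite mxE (negbTE ige).
exact: cst_continuous.
Qed.

Lemma w_rho_continuous w : {for w, continuous (@w_rho R)}.
Proof. exact: coord_continuous. Qed.

Lemma sysA_symmetrizable (Om : set (state R)) : Om `<=` @admissible R ->
  (forall w, Om w -> 0 < dotc (grad_Pi w) (stretch w)) -> symmetrizable Om sysA.
Proof.
move=> OmA pos.
exists (fun w => symmetrizer (w_rho w) (stretch w) (grad_Pi w)
  (fun j => base R (iK j)) (dvel w)) => w Omw.
have wA := OmA _ Omw; have [rho0 _ _ _] := wA; have gr0 := pos _ Omw.
have xx i j : dotc (base R (iK i)) (base R (iK j)) = (i == j)%:R.
  by rewrite dotc_base mxE eqxx andbT (inj_eq iK_inj).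
have dx := dvel_K w.
have dr j := dvel_stretch j wA.
have gx j := grad_Pi_K j wA.
split.
- apply: (@continuous_symmetrizer _ _ _ _ _ _ _ _ _ (fun j w => dvel w j)).
  + exact: w_rho_continuous.
  + exact: stretch_continuous.
  + exact: grad_Pi_continuous.
  + move=> j; apply: continuous_scalemx.
      exact: (cvgV (w_rho_coord_neq0 wA) (@w_rho_continuous w)).
    apply: continuous_addmx; first exact: cst_continuous.
    apply/continuous_oppmx/continuous_scalemx; last exact: cst_continuous.
    exact/differentiable_continuous/differentiable_w_u.
  + by rewrite gt_eqF.
  + exact: proj_orth_r_neq0 gr0 gx.
- exact: symmetrizer_posdef.
- move=> j; apply/is_hermitianmxP; rewrite expr0 scale1r map_mx_id//.
  by rewrite symmetrizer_mul_sym.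
Qed.

End quasilinear.

(** * The system of equations *)

Section dynamics.
Variables (R : realType) (X : two_phase_model R).
Implicit Types (w v : state R) (W : spacetime R -> state R) (z : spacetime R).
Hypotheses (hm : 0 < inertia_m X) (hnu : 0 < inertia_nu X).
Hypothesis he1 : class_C 2 [set p : R * R | 0 < p.1] (e1 X).
Hypothesis he2 : class_C 2 [set p : R * R | 0 < p.1] (e2 X).
Hypothesis hei : class_C 2 [set: R] (ei X).

Lemma forall_state_index (P : 'I_12 -> Prop) :
  P (@Ordinal 12 0 isT) -> (forall j, P (iK j)) ->
  P (@Ordinal 12 4 isT) -> P (@Ordinal 12 5 isT) -> P (@Ordinal 12 6 isT) ->
  P (@Ordinal 12 7 isT) -> P (@Ordinal 12 8 isT) -> P (@Ordinal 12 9 isT) ->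
  P (@Ordinal 12 10 isT) -> P (@Ordinal 12 11 isT) -> forall i, P i.
Proof.
move=> P0 PK P4 P5 P6 P7 P8 P9 P10 P11 [i ilt].
have PE (k : 'I_12) : i = k -> P k -> P (Ordinal ilt).
  by move=> ik Pk; have -> : Ordinal ilt = k by exact: val_inj.
move: i ilt PE => [|[|[|[|[|[|[|[|[|[|[|[|//]]]]]]]]]]]] ilt PE.
- exact: PE P0.
- by apply: PE (PK (@Ordinal 3 0 isT)).
- by apply: PE (PK (@Ordinal 3 1 isT)).
- by apply: PE (PK (@Ordinal 3 2 isT)).
- exact: PE P4.
- exact: PE P5.
- exact: PE P6.
- exact: PE P7.
- exact: PE P8.
- exact: PE P9.
- exact: PE P10.
- exact: PE P11.
Qed.

Section at_point.
Variables (W : spacetime R -> state R) (z : spacetime R).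
Hypotheses (dW : differentiable W z) (WA : admissible (W z)).

Lemma derive_state_fun (f : state R -> R) (v : spacetime R) :
  differentiable f (W z) -> 'D_v (fun z' => f (W z')) z = 'D_('D_v W z) f (W z).
Proof. by move=> df; rewrite (@derive_comp _ _ _ _ W f z v dW df). Qed.

Lemma derive_state_coord i (v : spacetime R) :
  'D_v (fun z' => W z' i 0) z = ('D_v W z) i 0.
Proof.
rewrite (@derive_state_fun (fun w => w i 0)) ?derive_coord//.
exact: differentiable_coord.
Qed.

Lemma divx_state (f : state R -> R) : differentiable f (W z) ->
  divx (fun z' => f (W z') *: w_u (W z')) z =
  \sum_j (f (W z) * dotc (dvel (W z) j) (dx j W z)
          + w_u (W z) 0 j * 'D_(dx j W z) f (W z)).
Proof.
move=> df; apply: eq_bigr => j _.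
rewrite /dx (_ : (fun _ => _) =
    (fun z' => f (W z')) * (fun z' => w_u (W z') 0 j)); last first.
  by apply/funext => z'; rewrite mxE.
have du := differentiable_w_u j WA.
rewrite deriveM; first last.
- exact/diff_derivable/(@differentiable_comp _ _ _ _ W (fun w => w_u w 0 j)).
- exact/diff_derivable/(@differentiable_comp _ _ _ _ W f).
by rewrite derive_state_fun// (derive_state_fun _ du) derive_w_u.
Qed.

Lemma divx_state_coord i :
  divx (fun z' => W z' i 0 *: w_u (W z')) z =
  \sum_j (W z i 0 * dotc (dvel (W z) j) (dx j W z)
          + w_u (W z) 0 j * dx j W z i 0).
Proof.
rewrite (@divx_state (fun w => w i 0)); last exact: differentiable_coord.
by apply: eq_bigr => j _; rewrite derive_coord.
Qed.

Lemma Dt_state_coord i :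
  Dt (fun z' => w_u (W z')) (fun z' => W z' i 0) z =
  dt W z i 0 + \sum_j w_u (W z) 0 j * dx j W z i 0.
Proof.
rewrite /Dt /dt derive_state_coord; congr (_ + _); apply: eq_bigr => j _.
by rewrite /dx derive_state_coord.
Qed.

Lemma dx_Lstar j :
  dx j (fun z' => Lstar X (W z')) z = - dotc (grad_Pi X (W z)) (dx j W z).
Proof.
rewrite /dx derive_state_fun; last exact: differentiable_Lstar.
by rewrite (grad_PiE hm hnu he1 he2 hei)// opprK.
Qed.

Let row i : R := (dt W z + \sum_(j < 3) sysA X j (W z) *m dx j W z) i 0.

Let rowE i : row i = dt W z i 0 + \sum_j (w_u (W z) 0 j * dx j W z i 0
  + (dotc (dvel (W z) j) (dx j W z) * stretch (W z) i 0
     + dotc (grad_Pi X (W z)) (dx j W z) * base R (iK j) i 0)).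
Proof.
rewrite /row mxE summxE; congr (_ + _); apply: eq_bigr => j _.
by rewrite sysA_mul !mxE.
Qed.

(** Serves rho, M and P: in div (f u) = u . grad f + f div u, the last term is the row of r d_j^T,
    since div u is the sum of the d_j . (dW / dx_j). *)
Let row_stretched (i : 'I_12) : (i < 6)%N -> ~~ (0 < i < 4)%N ->
  dt (fun z' => W z' i 0) z + divx (fun z' => W z' i 0 *: w_u (W z')) z = row i.
Proof.
move=> i6 i14; rewrite rowE /dt derive_state_coord divx_state_coord; congr (_ + _).
apply: eq_bigr => j _; rewrite [stretch _ _ _]mxE i6 [base _ _ _ _]mxE.
rewrite [i == _](_ : _ = false) ?mulr0; first by rewrite /dx; ring.
by apply: contraNF i14 => /eqP ->; rewrite /= add1n ltnS ltn_ord.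
Qed.

(** Compared with the other stretched rows there is the force - dx_i Lstar = g . (dW / dx_i); the
    factor e_{K_j} selects j = i in the sum. *)
Let row_K i : dt (fun z' => W z' (iK i) 0) z
    + divx (fun z' => W z' (iK i) 0 *: w_u (W z')) z
    - dx i (fun z' => Lstar X (W z')) z = row (iK i).
Proof.
rewrite rowE /dt derive_state_coord divx_state_coord dx_Lstar opprK -addrA.
congr (_ + _); rewrite [in RHS](eq_bigr (fun j : 'I_3 =>
    (W z (iK i) 0 * dotc (dvel (W z) j) (dx j W z)
     + w_u (W z) 0 j * dx j W z (iK i) 0)
    + dotc (grad_Pi X (W z)) (dx j W z) * (i == j)%:R)).
  rewrite [in RHS]big_split /=; congr (_ + _).
  rewrite (bigD1 i)//= eqxx mulr1 big1 ?addr0// => j ji.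
  by rewrite eq_sym (negbTE ji) mulr0.
move=> j _; rewrite [base _ _ _ _]mxE eqxx andbT (inj_eq (@iK_inj)).
rewrite [stretch _ _ _]mxE /= ifT; first by rewrite /dx; ring.
by rewrite add1n ltnS (ltn_trans (ltn_ord i)).
Qed.

Let row_transported (i : 'I_12) : (5 < i)%N ->
  Dt (fun z' => w_u (W z')) (fun z' => W z' i 0) z = row i.
Proof.
move=> i5; rewrite rowE Dt_state_coord; congr (_ + _); apply: eq_bigr => j _.
rewrite [stretch _ _ _]mxE ltnNge i5 /= mulr0 [base _ _ _ _]mxE.
rewrite [i == _](_ : _ = false) ?mulr0 ?addr0//.
apply/negP => /eqP ij; move: i5; rewrite ij /= add1n ltnS.
by rewrite ltnNge (ltnW (leq_trans (ltn_ord j) _)).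
Qed.

(** Each left-hand side is identically one row of the quasilinear operator, up to its source term,
    so both implications reduce to comparing the entries of [source]. *)
Lemma system_quasilinear : euler_lagrange_system X W z <->
  dt W z + \sum_(j < 3) sysA X j (W z) *m dx j W z = source X (W z).
Proof.
have h0 := @row_stretched (@Ordinal 12 0 isT) isT isT.
have h4 := @row_stretched (@Ordinal 12 4 isT) isT isT.
have h5 := @row_stretched (@Ordinal 12 5 isT) isT isT.
have h6 := @row_transported (@Ordinal 12 6 isT) isT.
have h7 := @row_transported (@Ordinal 12 7 isT) isT.
have h8 := @row_transported (@Ordinal 12 8 isT) isT.
have h9 := @row_transported (@Ordinal 12 9 isT) isT.
have h10 := @row_transported (@Ordinal 12 10 isT) isT.
have h11 := @row_transported (@Ordinal 12 11 isT) isT.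
have KE i : (fun z' => w_K (W z') 0 i) = (fun z' => W z' (iK i) 0).
  by apply/funext => z'; rewrite w_KE.
have KuE i : (fun z' => w_K (W z') 0 i *: w_u (W z')) =
    (fun z' => W z' (iK i) 0 *: w_u (W z')).
  by apply/funext => z'; rewrite w_KE.
have sK i : source X (W z) (iK i) 0 = 0.
  by case: i => -[|[|[|i]]] ilt //; rewrite !mxE /= !mulr0 !addr0.
split=> [[q0 [q11 q8 q9 q10] [q6 q7] [q4 q5] qK]|q].
  apply/colP; apply: forall_state_index; rewrite -/(row _).
  - by rewrite -h0 [LHS]q0 !mxE /= !mulr0 !addr0.
  - by move=> j; rewrite -/(row _) -row_K sK -KE -KuE; exact: qK.
  - rewrite -h4 !mxE /= !mulr0 !addr0 mulr1; exact: subr0_eq.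
  - rewrite -h5 !mxE /= !mulr0 !addr0 mulr1 add0r; exact: subr0_eq.
  - by rewrite -h6 [LHS]q6 !mxE /= !mulr0 !addr0 mulr1 !add0r.
  - by rewrite -h7 [LHS]q7 !mxE /= !mulr0 !addr0 mulr1 !add0r.
  - by rewrite -h8 [LHS]q8 !mxE /= !mulr0 !addr0.
  - by rewrite -h9 [LHS]q9 !mxE /= !mulr0 !addr0.
  - by rewrite -h10 [LHS]q10 !mxE /= !mulr0 !addr0.
  - by rewrite -h11 [LHS]q11 !mxE /= !mulr0 !addr0.
have rq i : row i = source X (W z) i 0 by rewrite /row q.
split.
- by rewrite [LHS]h0 rq !mxE /= !mulr0 !addr0.
- split.
  + by rewrite [LHS]h11 rq !mxE /= !mulr0 !addr0.
  + by rewrite [LHS]h8 rq !mxE /= !mulr0 !addr0.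
  + by rewrite [LHS]h9 rq !mxE /= !mulr0 !addr0.
  + by rewrite [LHS]h10 rq !mxE /= !mulr0 !addr0.
- split.
  + by rewrite [LHS]h6 rq !mxE /= !mulr0 !addr0 mulr1 !add0r.
  + by rewrite [LHS]h7 rq !mxE /= !mulr0 !addr0 mulr1 !add0r.
- split; apply/eqP; rewrite subr_eq0; apply/eqP.
  + by rewrite [LHS]h4 rq !mxE /= !mulr0 !addr0 mulr1.
  + by rewrite [LHS]h5 rq !mxE /= !mulr0 !addr0 mulr1 add0r.
- by move=> i; rewrite KE KuE row_K rq sK.
Qed.

Lemma energy_conservation : euler_lagrange_system X W z ->
  dt (fun z' => total_energy X (W z')) z
  + divx (fun z' => (total_energy X (W z') - Lstar X (W z')) *: w_u (W z')) z = 0.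
Proof.
move/system_quasilinear/(canRL (addrK _)) => dtW.
have dE := differentiable_energy hm hnu he1 he2 hei WA.
have dL := differentiable_Lstar hm hnu he1 he2 hei WA.
have dEL : differentiable (fun w => total_energy X w - Lstar X w) (W z).
  exact: (@differentiableB _ _ _ (total_energy X) (Lstar X)).
rewrite (divx_state dEL) /dt derive_state_fun// -/(dt W z) dtW.
rewrite deriveDdir// (derive_energy_source hm hnu he1 he2 hei WA) add0r.
rewrite -scaleN1r deriveZdir// derive_sumdir// /GRing.scale /= mulN1r addrC.
apply/eqP; rewrite subr_eq0; apply/eqP; apply: eq_bigr => j _.
(* Applied to A_j (dW / dx_j), grad E gives u_j D E from the transport, (E - Lstar) d_j . (dW /
   dx_j) from r, and u_j g . (dW / dx_j) = - u_j D Lstar from e_{K_j}, where D is the derivative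
   along dW / dx_j. This is the product rule for (E - Lstar) u_j. *)
rewrite sysA_mul !deriveDdir// !deriveZdir//.
rewrite (derive_energy_K hm hnu he1 he2 hei j WA).
rewrite (LstarE hm hnu he1 he2 hei WA) (grad_PiE hm hnu he1 he2 hei _ WA).
rewrite (deriveB (f := total_energy X)); try exact: diff_derivable.
by rewrite /GRing.scale /=; ring.
Qed.

End at_point.
End dynamics.

Theorem proposition3 (R : realType) (X : two_phase_model R)
  (he1 : class_C 2 [set p : R * R | 0 < p.1] (e1 X))
  (he2 : class_C 2 [set p : R * R | 0 < p.1] (e2 X))
  (hei : forall n : nat, class_C n [set: R] (ei X))
  (hT1 : forall tau s : R, 0 < tau -> 0 < temperature (e1 X) tau s)
  (hT2 : forall tau s : R, 0 < tau -> 0 < temperature (e2 X) tau s)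
  (hm : 0 < inertia_m X) (hnu : 0 < inertia_nu X) :
  (forall (U : set (spacetime R)) (W : spacetime R -> state R),
     open U ->
     class_C 1 U W ->
     (forall z, U z -> admissible (W z)) ->
     (forall z, U z -> euler_lagrange_system X W z) ->
     forall z, U z ->
       dt (fun z' => total_energy X (W z')) z
       + divx (fun z' =>
           (total_energy X (W z') - Lstar X (W z')) *: w_u (W z')) z = 0)
  /\
  (forall Om : set (state R),
     open Om -> convex_set Om -> Om `<=` @admissible R ->
     convex_function Om (total_energy X) ->
     exists (A : 'I_3 -> state R -> 'M[R]_12) (S : state R -> state R),
       [/\ quasilinear_form (euler_lagrange_system X) Om A S,
           hyperbolic Om A &
           symmetrizable Om A]).
Proof.
have hei2 := hei 2%N; split=> [U W oU [dW _] WA sys z Uz|Om oOm _ OmA cE].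
  by apply: (energy_conservation hm hnu he1 he2 hei2); [exact: dW|exact: WA|exact: sys].
(* Convexity enters only through this positivity, which then serves both hyperbolicity and the
   symmetrizer. *)
have pos w : Om w -> 0 < dotc (grad_Pi X w) (stretch w).
  move=> Omw; rewrite (grad_Pi_stretch hm hnu he1 he2 hei2); last exact: OmA.
  exact: (energy_hessian_stretch_gt0 hm hnu he1 he2 hei2 hT1 oOm OmA cE Omw).
exists (sysA X), (source X); split.
- move=> W z dW Omz.
  exact: (system_quasilinear hm hnu he1 he2 hei2 dW (OmA _ Omz)).
- exact: (sysA_hyperbolic hm hnu he1 he2 hei2 OmA pos).
- exact: (sysA_symmetrizable hm hnu he1 he2 hei2 OmA pos).
Qed.
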